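(* Let $n\geq 3$ and let $\mathrm{Out}(F_n)$ be the outer automorphism group of the free group $F_n$ of rank $n$. Then $\Phi(\mathrm{Out}(F_n))=\Phi_f(\mathrm{Out}(F_n))=1$.
   Context: For a group $G$, a maximal subgroup is a proper subgroup maximal with respect to inclusion among proper subgroups. The Frattini subgroup $\Phi(G)$ is the intersection of all maximal subgroups of $G$ if such exist, and $\Phi(G)=G$ otherwise. $\Phi_f(G)$ is the intersection of all maximal subgroups of finite index in $G$ (taken to be $G$ if there are none). *)

(* Defs.v *)
From mathcomp Require Import all_boot.
From Stdlib Require Import ClassicalEpsilon.

Set Implicit Arguments.
Unset Strict Implicit.
Unset Printing Implicit Defensive.

(* A letter (i, false) is x_i, a letter (i, true) is x_i^{-1}.         *)
Definition letter (n : nat) := ('I_n * bool)%type.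
Definition linv n (a : letter n) : letter n := (a.1, ~~ a.2).
Definition nocancel n : rel (letter n) := fun a b => b != linv a.
Definition reduced n (s : seq (letter n)) := sorted (@nocancel n) s.

Definition cons_red n (x : letter n) (s : seq (letter n)) : seq (letter n) :=
  if s is y :: s' then (if y == linv x then s' else x :: s) else [:: x].
Definition red n (s : seq (letter n)) : seq (letter n) := foldr (@cons_red n) [::] s.

Lemma cons_red_reduced n (x : letter n) (s : seq (letter n)) :
  reduced s -> reduced (cons_red x s).
Proof.
case: s => [|y s] //= H; case: ifP => E; first exact: path_sorted H.
by rewrite /reduced /= /nocancel E H.
Qed.

Lemma red_reduced n (s : seq (letter n)) : reduced (red s).
Proof. by elim: s => [|x s IH] //=; apply: cons_red_reduced. Qed.

Definition FG (n : nat) := {s : seq (letter n) | reduced s}.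
Definition fg_mul n (u v : FG n) : FG n :=
  exist _ (red (proj1_sig u ++ proj1_sig v)) (red_reduced _).

Definition is_hom n (f : FG n -> FG n) :=
  forall u v, f (fg_mul u v) = fg_mul (f u) (f v).
Definition is_aut n (f : FG n -> FG n) := is_hom f /\ bijective f.

Lemma id_aut n : is_aut (@id (FG n)).
Proof. by split; [move=> u v | exists id]. Qed.

Lemma comp_aut n (f g : FG n -> FG n) : is_aut f -> is_aut g -> is_aut (f \o g).
Proof.
move=> [hf bf] [hg bg]; split; last exact: bij_comp.
by move=> u v /=; rewrite hg hf.
Qed.

(* the class phi.Inn(F_n) of an automorphism phi: all automorphisms psi
   with psi(u) = g^{-1} phi(u) g for some g, i.e. g psi(u) = phi(u) g *)
Definition out_class n (phi : FG n -> FG n) : (FG n -> FG n) -> Prop :=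
  fun psi => is_aut psi /\ exists g : FG n, forall u, fg_mul g (psi u) = fg_mul (phi u) g.

Definition Out (n : nat) :=
  {C : (FG n -> FG n) -> Prop | exists phi, is_aut phi /\ C = out_class phi}.

Definition out_rep n (C : Out n) : FG n -> FG n :=
  proj1_sig (constructive_indefinite_description _ (proj2_sig C)).

Lemma out_rep_aut n (C : Out n) : is_aut (out_rep C).
Proof.
exact: (proj1 (proj2_sig (constructive_indefinite_description _ (proj2_sig C)))).
Qed.

Definition out_mul n (C D : Out n) : Out n :=
  exist _ (out_class (out_rep C \o out_rep D))
    (ex_intro _ (out_rep C \o out_rep D)
       (conj (comp_aut (out_rep_aut C) (out_rep_aut D)) erefl)).

Definition out_one n : Out n :=
  exist _ (out_class (@id (FG n))) (ex_intro _ id (conj (@id_aut n) erefl)).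

Section GroupNotions.
Variables (T : Type) (mul : T -> T -> T) (one : T).

Definition subgroup (H : T -> Prop) :=
  [/\ H one, (forall x y, H x -> H y -> H (mul x y))
    & (forall x, H x -> exists y, H y /\ mul x y = one)].

Definition maximal_subgroup (M : T -> Prop) :=
  [/\ subgroup M, (exists g, ~ M g)
    & forall K, subgroup K -> (forall x, M x -> K x) -> (exists g, ~ K g) ->
        forall x, K x -> M x].

Definition finite_index (M : T -> Prop) :=
  exists s : list T, forall g, exists x m, List.In x s /\ M m /\ g = mul x m.

(* Frattini subgroup: intersection of all maximal subgroups (= whole
   group if there are none, as the empty intersection) *)
Definition frattini (g : T) := forall M, maximal_subgroup M -> M g.
Definition frattini_f (g : T) :=
  forall M, maximal_subgroup M -> finite_index M -> M g.

End GroupNotions.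

(* Main.v *)
From HB Require Import structures.
Require Import Defs.
From mathcomp Require Import all_boot all_fingroup all_solvable all_algebra boolp ring.

(**
The image of the Frattini subgroup in a finite quotient Q of Out(F_n) lies in
Phi(Q), which is nilpotent and normal. Take S = PSL(2,p) and let Out(F_n) act
on the finite set of kernels of homomorphisms F_n -> S. If f maps the free
factor A generated by the x_i, i <> j, onto S, the kernels of the maps f_s that
agree with f on A and send x_j to s form a copy O of S. As S is simple, some
w in A has prescribed image f(w) and is killed by every homomorphism whose
restriction to A does not have the kernel of f|A; hence x_j -> w x_j and
x_j -> x_j w act on O by left and right translation and fix every other point.
A nilpotent normal subgroup of a permutation group containing these
translations fixes O pointwise. So an outer automorphism phi in the Frattini
subgroup preserves ker (f o theta) for all such f and all automorphisms theta.

Now let f(x_i) be a transvection X, of order p, and the other f(x_k) be of the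
form X^a Y^t X^b. The trace of the image of a cyclically reduced word is a
polynomial in t whose degree is the number of letters distinct from x_i and
its inverse; for a good choice of t it is not 2 or -2, in which case the image
does not have order p. Therefore phi(w) is conjugate to a power of w, and in
fact to w or its inverse, for every primitive w. For n >= 3 an automorphism
with this property is inner: this is seen on the x_i, x_i x_j and x_i x_j x_k,
the trace degree again recovering the length of a cyclically reduced word.
*)

Set Implicit Arguments.
Unset Strict Implicit.
Unset Printing Implicit Defensive.

Import GroupScope GRing.Theory.

(** * Nilpotent normal subgroups of permutation groups *)

(** By the Frattini argument G = Phi(G) N_G(P) for each Sylow subgroup P of Phi(G). As Phi(G)
    consists of non-generators, P is normal in G, hence lies in the Fitting subgroup of Phi(G). *)
Lemma Phi_nilpotent (gT : finGroupType) (G : {group gT}) : nilpotent 'Phi(G).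
Proof.
suff sPF : 'Phi(G) \subset 'F('Phi(G)).
  have eF : 'F('Phi(G)) = 'Phi(G) :> {set gT}.
    by apply/eqP; rewrite eqEsubset Fitting_sub.
  by rewrite -{1}eF Fitting_nil.
rewrite -{1}(Sylow_gen [group of 'Phi(G)]) gen_subG.
apply/bigcupsP => P /SylowP[p _ sylP].
apply: Fitting_max; last exact: pgroup_nil (pHall_pgroup sylP).
have sP := pHall_sub sylP.
have nG : 'N_G(P) = G.
  have E : 'Phi(G) * 'N_G(P) = G := Frattini_arg (Phi_normal G) sylP.
  have := @Phi_nongen _ G 'N_G(P); rewrite genGid; apply.
  by rewrite norm_joinEr // subIset // (normal_norm (Phi_normal G)).
apply/andP; split=> //; apply: subset_trans (Phi_sub G) _.
by rewrite -nG subsetIr.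
Qed.

Section NilpotentNormal.
Variables (rT : finType) (gT : finGroupType) (Q N : {group {perm rT}}) (o : gT -> rT).
Hypotheses (o_inj : injective o) (simT : simple [set: gT]) (cT : 'Z([set: gT]) = 1).
Variable sg : gT.
Hypotheses (sg1 : sg != 1) (sg2 : sg * sg = 1).
Hypothesis lft : forall a, exists2 q, q \in Q &
  (forall s, q (o s) = o (a * s)) /\ (forall x, x \notin codom o -> q x = x).
Hypothesis rgt : forall a, exists2 q, q \in Q &
  (forall s, q (o s) = o (s * a)) /\ (forall x, x \notin codom o -> q x = x).
Hypotheses (nNQ : N <| Q) (nilN : nilpotent N).

Definition fixes_codom (K : {group {perm rT}}) := [forall k in K, forall s, k (o s) == o s].

(** The points [o s] form a copy of [gT] on which Q induces all left and right translations without
    moving other points. In a minimal counterexample K, the K-orbit of [o 1] either stays inside the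
    copy or leaves it, and both cases are refuted. *)
Lemma nilpotent_normal_fix k s : k \in N -> k (o s) = o s.
Proof.
(* K is taken minimal among the normal subgroups of Q inside N that move some [o s]; its proper
   characteristic subgroups then fix all these points. *)
pose P := [pred K : {group {perm rT}} | [&& K <| Q, K \subset N & ~~ fixes_codom K]].
have [fN|nfN] := boolP (fixes_codom N).
  by move=> kN; move/forall_inP/(_ k kN)/forallP/(_ s)/eqP: fN.
move=> _; exfalso; clear k s.
have PN : P N by rewrite /= nNQ subxx.
have [K /mingroupP[/and3P[nKQ sKN nfK] minK] _] := mingroup_exists PN.
have minK' (H : {group {perm rT}}) : H \char K -> H != K :> {set _} -> fixes_codom H.
  move=> cHK; apply: contraNT => nfH; rewrite (minK H) //; last exact: char_sub.
  rewrite /P /= nfH andbT (char_normal_trans cHK) //=.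
  exact: subset_trans (char_sub cHK) sKN.
have nilK : nilpotent K := nilpotentS sKN nilN.
have fixK (H : {group {perm rT}}) h t : fixes_codom H -> h \in H -> h (o t) = o t.
  by move=> fH hH; move/forall_inP/(_ h hH)/forallP/(_ t)/eqP: fH.
have Kn1 : K != 1 :> {set _}.
  apply: contraNneq nfK => K1; apply/forall_inP => h; rewrite K1 => /set1P ->.
  by apply/forallP => t; rewrite perm1.
(* By minimality the derived group of K fixes every o t, so K acts on the
   orbits of these points through an abelian quotient. *)
have comK h j l t : h \in K -> j \in K -> l \in K ->
    (h * j) (l (o t)) = (j * h) (l (o t)).
  move=> hK jK lK.
  have fD : fixes_codom K^`(1)%G.
    apply: minK'; first exact: der_char.
    have := sol_der1_proper (nilpotent_sol nilK) (subxx _) Kn1.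
    by rewrite properEneq => /andP[].
  have rD : [~ h^-1, j^-1] ^ l^-1 \in K^`(1).
    rewrite memJ_norm ?mem_commg ?groupV //.
    by apply: (subsetP (normal_norm (der_normal 1 K))).
  have /(congr1 l) := fixK _ _ t fD rD.
  rewrite conjgE invgK -permM mulgA mulgVK permM => /(congr1 (j * h)).
  rewrite -permM => <-; have -> // : [~ h^-1, j^-1] * (j * h) = h * j.
  by rewrite commgEl conjgE !invgK !mulgA !mulgVK.
(* A nilpotent K is the product of its 2-part and its 2'-part, both characteristic. If both were
   proper, both would fix the points, and so would K. *)
have oddK : 2.-group K || 2^'.-group K.
  apply: contraNT nfK; rewrite negb_or => /andP[n2 n2'].
  have f2 : fixes_codom 'O_2(K)%G.
    apply: minK'; first exact: pcore_char.
    by apply: contraNneq n2 => <-; apply: pcore_pgroup.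
  have f2' : fixes_codom 'O_2^'(K)%G.
    apply: minK'; first exact: pcore_char.
    by apply: contraNneq n2' => <-; apply: pcore_pgroup.
  apply/forall_inP => h hK; apply/forallP => t.
  have : h \in 'O_2(K) * 'O_2^'(K) by rewrite (dprodW (nilpotent_pcoreC 2 nilK)).
  by case/mulsgP => a b aO bO ->; rewrite permM (fixK _ _ _ f2 aO) (fixK _ _ _ f2' bO).
have nK q h : q \in Q -> h \in K -> h ^ q \in K.
  by move=> qQ hK; rewrite memJ_norm // (subsetP (normal_norm nKQ)).
have [k0 k0K k0m] : exists2 h, h \in K & h (o 1) != o 1.
  move: nfK; rewrite negb_forall_in => /exists_inP[h hK]; rewrite negb_forall.
  case/existsP => t ht; have [q qQ [qL _]] := lft t^-1.
  exists (h ^ q); first exact: nK.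
  have E : q (o t) = o 1 by rewrite qL mulVg.
  rewrite -E -permM conjgE mulgA mulgV mul1g permM.
  by rewrite (inj_eq perm_inj).
have qorb q x : q \in Q -> orbit 'P K (q x) = [set q z | z in orbit 'P K x].
  move=> qQ; apply/setP => z; apply/orbitP/imsetP => [[h hK <-]|[_ /orbitP[h hK <-] ->]].
    exists (aperm x (h ^ q^-1)); last by rewrite /= /aperm -!permM conjgE invgK mulgA mulgVK.
    by apply: mem_orbit; rewrite nK ?groupV.
  by exists (h ^ q); rewrite ?nK //= /aperm -!permM conjgE mulgA mulgV mul1g.
set B := orbit 'P K (o 1).
have o1B : o 1 \in B by apply: orbit_refl.
have oB x y : x \in B -> y \in orbit 'P K x = (y \in B).
  by move=> xB; rewrite /B (orbit_eqP xB).
(* If B is contained in codom o then it is all of it, so #|gT| is even and divides #|K|. *)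
have [sBO|] := boolP (B \subset codom o).
  have qB q x : q \in Q -> x \in B -> q x \in B -> forall z, z \in B -> q z \in B.
    move=> qQ xB qxB z zB; have : q z \in orbit 'P K (q x).
      by rewrite qorb // imset_f // oB.
    by rewrite oB.
  (* B is a block for Q. Left translations therefore make U a subgroup, and two-sided translations
     make it normal; [k0] shows that it is not trivial. *)
  pose U := [set u | o u \in B].
  have gU : group_set U.
    apply/group_setP; split=> [|u v]; rewrite !inE // => uB vB.
    have [q qQ [qL _]] := lft u; rewrite -qL.
    by apply: (qB q (o 1)) => //; rewrite qL mulg1.
  have nU : Group gU <| [set: gT].
    rewrite /normal subsetT; apply/subsetP => g _; rewrite inE; apply/subsetP => _ /imsetP[u uU ->].
    have [q qQ [qL _]] := lft g^-1; have [r rQ [rR _]] := rgt g.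
    have E v : (q * r) (o v) = o (v ^ g) by rewrite permM qL rR conjgE mulgA.
    move: uU; rewrite !inE => uU; rewrite -E.
    by apply: (qB _ (o 1)); rewrite ?groupM // E conj1g.
  have /simpleP[T1 sT] := simT.
  have UT : U = [set: gT].
    have [E|//] := sT _ nU; exfalso.
    have k0B : k0 (o 1) \in B by apply: mem_orbit.
    have /codomP[u Eu] := subsetP sBO _ k0B.
    have : u \in Group gU by rewrite inE -Eu.
    rewrite E => /set1P u1; by rewrite Eu u1 eqxx in k0m.
  have cB : #|B| = #|[set: gT]|.
    rewrite -UT -(card_imset _ o_inj); congr #|pred_of_set _|; apply/setP => x.
    apply/idP/imsetP => [xB|[u]]; last by rewrite inE => ? ->.
    have /codomP[u Eu] := subsetP sBO _ xB; exists u => //; by rewrite inE -Eu.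
  have dvK : #|[set: gT]| %| #|K| by rewrite -cB dvdn_orbit.
  have d2 : 2 %| #|[set: gT]|.
    have <- : #[sg] = 2 by apply: nt_prime_order; rewrite // expgS expg1.
    by apply: order_dvdG; rewrite inE.
  (* If K is a 2-group, so is [gT], which would then have a nontrivial centre; if K has odd order,
     the involution [sg] gives the contradiction. *)
  case/orP: oddK => pK.
    have pT : 2.-group [set: gT] := pnat_dvd dvK pK.
    by move: T1; rewrite (trivg_center_pgroup pT cT) eqxx.
  move: (pnat_dvd (dvdn_trans d2 dvK) pK); by [].
(* Translations by gT fix y, hence act as automorphisms on B, a torsor under an
   abelian group. An involution sg of gT inverts e s up to an element sending y to
   w s; this point is fixed by all translations and does not depend on s, so sg is
   central. *)
case/subsetPn => y yB nyO.
have oyB s : o s \in orbit 'P K y.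
  have [q qQ [qL qf]] := lft s.
  have : q (o 1) \in [set q z | z in orbit 'P K y] by rewrite imset_f // orbit_sym oB.
  by rewrite -qorb // qL mulg1 qf.
have eK s : {h | h \in K & h y = o s}.
  by apply: sig2_eqW; have /orbitP[h hK hE] := oyB s; exists h.
pose e s := s2val (eK s).
have eKK s : e s \in K by rewrite /e; case: (eK s).
have ey s : e s y = o s by rewrite /e; case: (eK s).
have eqK h j : h \in K -> j \in K -> h y = j y -> forall s, h (o s) = j (o s).
  move=> hK jK E s; have yl : exists2 l, l \in K & y = l (o 1).
    by move/orbitP: yB => [l lK <-]; exists l.
  case: yl => l lK yE; rewrite -ey yE -!permM.
  have C g : g \in K -> (e s * g) y = (g * e s) y.
    by move=> gK; rewrite yE; apply: comK.
  by rewrite !mulgA !permM -!yE -!permM !C // !permM E.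
have qE (q h : {perm rT}) x : q (h x) = (h ^ q) (q x).
  by rewrite -!permM conjgE !mulgA mulgV mul1g.
have ecj q s t u : q \in Q -> (forall x, x \notin codom o -> q x = x) -> q (o s) = o t ->
    (e s ^ q) (o u) = e t (o u).
  move=> qQ qf qs; apply: eqK; rewrite ?nK ?ey //.
  by rewrite -{1}(qf y nyO) -qE ey.
have [qs qsQ [qsL qsf]] := lft sg.
pose w s := e s (o (sg * s)).
(* Translation by [sg] fixes y and exchanges [o s] with [o (sg * s)]. As K acts commutatively on B,
   it fixes [w s]; but it has no fixed point in the image of [o]. *)
have wn s : w s \notin codom o.
  have qw : qs (w s) = w s.
    rewrite /w qE qsL mulgA sg2 mul1g -(ey s) -permM.
    have -> : (e s * e s ^ qs) y = (e s ^ qs * e s) y.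
      by case/orbitP: (yB) => l lK <-; apply: comK; rewrite ?nK.
    by rewrite permM -{1}(qsf y nyO) -qE ey qsL.
  apply/negP => /codomP[u Eu]; move: qw; rewrite Eu qsL => /o_inj /eqP.
  by rewrite -{2}(mul1g u) (inj_eq (mulIg u)) (negPf sg1).
have w1 s : w s = w 1.
  have [q qQ [qR qf]] := rgt s.
  by rewrite -[RHS](qf _ (wn 1)) /w qE qR mulg1 (ecj q 1 s) ?qR ?mul1g.
have /negP[] := sg1; rewrite -in_set1 -[[set 1]]cT; apply/centerP; split=> [|m _]; first exact: in_setT.
have [q qQ [qL qf]] := lft m.
have := qf _ (wn 1); rewrite {1}/w qE qL (ecj q 1 m) ?qL ?mulg1 //.
by rewrite -(w1 m) /w => /perm_inj /o_inj.
Qed.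
End NilpotentNormal.

(** * The free group *)

Section Words.
Variable n : nat.
Implicit Types (x y : letter n) (s t : seq (letter n)).

Lemma linvK : involutive (@linv n).
Proof. by case=> i b; rewrite /linv negbK. Qed.

(** Van der Waerden's argument: each letter permutes the reduced words. Associativity of the product
    of the free group comes from this. *)
Lemma cons_redK x s : reduced s -> cons_red x (cons_red (linv x) s) = s.
Proof.
case: s => [|y s] /= rs; first by rewrite eqxx.
move: rs; rewrite linvK; have [->|nyx] := eqVneq y x; last by rewrite /= eqxx.
case: s => [|z s] //= /andP[nxz _].
by rewrite (negPf (nxz : z != linv x)).
Qed.

Lemma red_id s : reduced s -> red s = s.
Proof.
elim: s => [|x s IH] //= rs; rewrite IH; last exact: path_sorted rs.
case: s rs {IH} => [|y s] //= /andP[nxy _]; by rewrite (negPf (nxy : y != linv x)).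
Qed.

Lemma red_cons_red x s t : red (cons_red x s ++ t) = cons_red x (red (s ++ t)).
Proof.
case: s => [|y s] //=; case: eqP => // ->.
by rewrite -{2}(linvK x) /= linvK cons_redK ?red_reduced.
Qed.

Lemma red_catl s t : red (red s ++ t) = red (s ++ t).
Proof. by elim: s => [|x s IH] //=; rewrite red_cons_red IH. Qed.

Lemma red_catr s t : red (s ++ red t) = red (s ++ t).
Proof. by rewrite /red !foldr_cat -/(red _) (red_id (red_reduced t)). Qed.

Definition winv s := rev (map (@linv n) s).

Lemma winvK : involutive winv.
Proof. by move=> s; rewrite /winv map_rev revK (mapK linvK). Qed.

Lemma red_winv s : red (winv s ++ s) = [::].
Proof.
elim: s => [|x s IH] //; rewrite /winv /= rev_cons cat_rcons.
rewrite -red_catr /= -{2}(linvK x) cons_redK ?red_reduced //.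
by rewrite red_catr.
Qed.

Lemma reduced_winv s : reduced s -> reduced (winv s).
Proof.
rewrite /reduced /winv rev_sorted sorted_map; apply: sub_sorted => x y /=.
by rewrite /nocancel /= linvK eq_sym.
Qed.

Definition word s : FG n := exist _ (red s) (red_reduced s).

Lemma word_val (u : FG n) : word (val u) = u.
Proof. by apply: val_inj; rewrite /= red_id ?(valP u). Qed.

Definition fg_inv (u : FG n) := word (winv (val u)).
Definition fg_one := word [::].

Lemma fg_mulA : associative (@fg_mul n).
Proof. by move=> u v w; apply: val_inj; rewrite /= red_catl red_catr catA. Qed.
Lemma fg_mul1 : left_id fg_one (@fg_mul n).
Proof. by move=> u; apply: val_inj; rewrite /= red_id ?(valP u). Qed.
Lemma fg_mulr1 : right_id fg_one (@fg_mul n).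
Proof. by move=> u; apply: val_inj; rewrite /= cats0 red_id ?(valP u). Qed.
Lemma fg_mulV : left_inverse fg_one fg_inv (@fg_mul n).
Proof. by move=> u; apply: val_inj; rewrite /= red_catl red_winv. Qed.
Lemma fg_mulrV : right_inverse fg_one fg_inv (@fg_mul n).
Proof. by move=> u; apply: val_inj; rewrite /= red_catr -{1}(winvK (val u)) red_winv. Qed.

End Words.

HB.instance Definition _ n := Choice.copy (FG n) {s : seq (letter n) | reduced s}.
HB.instance Definition _ n :=
  isGroup.Build (FG n) (@fg_mulA n) (@fg_mul1 n) (@fg_mulr1 n) (@fg_mulV n) (@fg_mulrV n).

Section Eval.
Variable n : nat.
Implicit Types (x : letter n) (s t : seq (letter n)).

Lemma word_cat s t : word (s ++ t) = word s * word t.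
Proof. by apply: val_inj; rewrite /= red_catl red_catr. Qed.

Lemma word_winv s : word (winv s) = (word s)^-1.
Proof.
by apply: (mulIg (word s)); rewrite mulVg -word_cat; apply: val_inj; rewrite /= red_winv.
Qed.

Section Red.
Variables (T : Type) (idx : T) (op : Monoid.law idx) (m : letter n -> T).
Hypothesis mV : forall x, op (m x) (m (linv x)) = idx.

(** Stated for any monoid because it serves both for evaluation in groups and for products of
    matrices over commutative rings. *)
Lemma big_red s : \big[op/idx]_(x <- red s) m x = \big[op/idx]_(x <- s) m x.
Proof.
elim: s => [|x s IH] //; rewrite [RHS]big_cons -IH /=.
case: (red s) => [|y r]; rewrite [cons_red x _]/=; first by rewrite big_cons.
case: eqP => [->|_]; last by rewrite big_cons.
rewrite big_cons; transitivity (op (op (m x) (m (linv x))) (\big[op/idx]_(z <- r) m z)).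
  by rewrite mV Monoid.mul1m.
exact/esym/Monoid.mulmA.
Qed.
End Red.

Section Group.
Variables (G : groupType).
Implicit Types h : 'I_n -> G.

Definition lval h x := if x.2 then (h x.1)^-1 else h x.1.
Definition ev h s := \prod_(x <- s) lval h x.

Lemma lval_linv h x : lval h (linv x) = (lval h x)^-1.
Proof. by rewrite /lval /=; case: x.2; rewrite /= ?invgK. Qed.

Lemma ev_cons h x s : ev h (x :: s) = lval h x * ev h s.
Proof. exact: big_cons. Qed.

Lemma ev_nil h : ev h [::] = 1.
Proof. exact: big_nil. Qed.

Lemma ev_cat h s t : ev h (s ++ t) = ev h s * ev h t.
Proof. exact: big_cat. Qed.

Lemma ev_winv h s : ev h (winv s) = (ev h s)^-1.
Proof.
elim: s => [|x s IH]; first by rewrite ev_nil invg1.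
by rewrite /winv /= rev_cons -cats1 ev_cat IH !ev_cons ev_nil mulg1 invgM lval_linv.
Qed.

Lemma ev_red h s : ev h (red s) = ev h s.
Proof. by apply: big_red => x; rewrite lval_linv /= mulgV. Qed.

Lemma ev_wordE h s : ev h (val (word s)) = ev h s.
Proof. exact: ev_red. Qed.

Lemma ev_mul h (u v : FG n) : ev h (val (u * v)) = ev h (val u) * ev h (val v).
Proof. by rewrite /= ev_red ev_cat. Qed.

Lemma eq_in_ev h h' s : {in s, forall x, h x.1 = h' x.1} -> ev h s = ev h' s.
Proof. by move=> E; apply: eq_big_seq => x xs; rewrite /lval E. Qed.

Definition gen i : FG n := word [:: (i, false)].

Lemma ev_gen h i : ev h (val (gen i)) = h i.
Proof. by rewrite ev_red ev_cons ev_nil mulg1. Qed.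

End Group.

Lemma ev_word s : ev gen s = word s.
Proof.
elim: s => [|[i b] s IH]; first by rewrite ev_nil.
rewrite ev_cons IH -[_ :: s]cat1s word_cat; congr (_ * _).
by rewrite /lval; case: b => //=; rewrite -word_winv.
Qed.

Section Morph.
Variables (G H : groupType).

Lemma morph_one (f : G -> H) : {morph f : u v / u * v} -> f 1 = 1.
Proof. by move=> fM; apply: (mulgI (f 1)); rewrite -fM !mulg1. Qed.

Lemma morph_inv (f : G -> H) : {morph f : u v / u * v} -> {morph f : u / u^-1}.
Proof. by move=> fM u; apply: (mulgI (f u)); rewrite -fM !mulgV morph_one. Qed.

Lemma morph_X (f : G -> H) k : {morph f : u v / u * v} -> {morph f : u / u ^+ k}.
Proof.
by move=> fM u; elim: k => [|k IH]; rewrite ?morph_one // !expgS fM IH.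
Qed.

Lemma morph_ev (f : G -> H) (h : 'I_n -> G) s :
  {morph f : u v / u * v} -> f (ev h s) = ev (f \o h) s.
Proof.
move=> fM; elim: s => [|x s IH]; first by rewrite !ev_nil morph_one.
by rewrite !ev_cons fM IH /lval; case: x.2; rewrite /= ?morph_inv.
Qed.
End Morph.

Lemma morph_word (G : groupType) (f : FG n -> G) s :
  {morph f : u v / u * v} -> f (word s) = ev (f \o gen) s.
Proof. by move=> fM; rewrite -ev_word (morph_ev _ _ fM). Qed.

Lemma morph_FG (G : groupType) (f : FG n -> G) u :
  {morph f : u v / u * v} -> f u = ev (f \o gen) (val u).
Proof. by move=> fM; rewrite -{1}(word_val u) morph_word. Qed.

End Eval.

(** * Frattini subgroups of finite quotients *)

Section FrattiniImage.
Variables (T : Type) (mul : T -> T -> T) (one : T) (inv : T -> T).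
Hypotheses (mulA : associative mul) (mul1 : left_id one mul) (mulV : right_inverse one inv mul).
Variables (gT : finGroupType) (rho : T -> gT) (Q : {group gT}).
Hypotheses (rhoM : forall x y, rho (mul x y) = rho x * rho y).
Hypothesis rhoQ : forall q, q \in Q <-> exists x, rho x = q.

(** The preimage of a maximal subgroup of the finite group Q is maximal of finite index, so it
    contains [g]. *)
Lemma frattini_f_image g : frattini_f mul one g -> rho g \in 'Phi(Q).
Proof.
move=> fg; apply/bigcapP => M /orP[/eqP->|maxM]; first by apply/rhoQ; exists g.
have rho1 : rho one = 1 by apply: (mulgI (rho one)); rewrite -rhoM mul1 mulg1.
have rhoV x : rho (inv x) = (rho x)^-1.
  by apply: (mulgI (rho x)); rewrite -rhoM mulV rho1 mulgV.
have rQ x : rho x \in Q by apply/rhoQ; exists x.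
case/maxgroupP: maxM => pMQ maxM; have [sMQ [q0 q0Q q0M]] := properP pMQ.
apply: (fg (fun x => rho x \in M)); last first.
  have ex q : exists x, q \in Q -> rho x = q.
    have [/rhoQ[x <-]|] := boolP (q \in Q); first by exists x.
    by move=> nq; exists one.
  have [c cE] := choice ex.
  exists [seq c q | q <- enum Q] => y; exists (c (rho y)), (mul (inv (c (rho y))) y).
  split; last split.
  - have : rho y \in enum Q by rewrite mem_enum.
    elim: (enum Q) => [|q s IH] //=; rewrite inE => /orP[/eqP ->|/IH]; first by left.
    by right.
  - by rewrite rhoM rhoV cE // mulVg group1.
  by rewrite mulA mulV mul1.
split.
- split=> [|x y xM yM|x xM]; first by rewrite rho1 group1.
    by rewrite rhoM groupM.
  by exists (inv x); rewrite rhoV groupV.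
- by have /rhoQ[x xE] := q0Q; exists x; rewrite xE; apply/negP.
move=> K [K1 KM KV] sMK [y Ky] x Kx.
pose L := [set q | `[< exists2 x, K x & rho x = q >]].
have gL : group_set L.
  apply/group_setP; split=> [|a b]; rewrite !inE; first by apply/asboolP; exists one.
  move=> /asboolP[u Ku <-] /asboolP[v Kv <-]; apply/asboolP; exists (mul u v) => //.
  exact: KM.
(* K contains the preimage of M, hence the kernel of [rho], so it is a union of fibres and is
   determined by its image L. *)
have kerK u v : K u -> rho u = rho v -> K v.
  move=> Ku E; have -> : v = mul u (mul (inv u) v) by rewrite mulA mulV mul1.
  by apply: KM => //; apply: sMK; rewrite rhoM rhoV E mulVg group1.
have <- : Group gL = M :> {set gT}.
  apply: maxM.
    apply/properP; split.
      by apply/subsetP => q; rewrite inE => /asboolP[u _ <-].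
    exists (rho y) => //; rewrite inE; apply/asboolP => -[u Ku /(kerK _ _ Ku)].
    by [].
  apply/subsetP => q qM; rewrite inE; apply/asboolP.
  have /rhoQ[u uE] := subsetP sMQ q qM; exists u => //; apply: sMK.
  by rewrite uE.
by rewrite inE; apply/asboolP; exists x.
Qed.

End FrattiniImage.

(** * The group structure of Out(F_n) *)

Section OutGroup.
Variable n : nat.
Implicit Types (phi psi : FG n -> FG n) (C D : Out n).

Lemma aut_morph phi : is_aut phi -> {morph phi : u v / u * v}.
Proof. by case. Qed.

Lemma out_class_eq phi psi (g : FG n) : is_aut phi -> is_aut psi ->
  (forall u, g * psi u = phi u * g) -> out_class phi = out_class psi.
Proof.
move=> aphi apsi E; apply/funext => chi; apply/propext; split=> -[achi [h hE]].
  split=> //; exists (g^-1 * h) => u; rewrite /fg_mul -/(fg_mul _ _).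
  change (g^-1 * h * chi u = psi u * (g^-1 * h)).
  rewrite -mulgA (hE u : h * chi u = phi u * h) !mulgA; congr (_ * _).
  by apply: (mulgI g); rewrite !mulgA mulgV mul1g E mulgK.
split=> //; exists (g * h) => u.
change (g * h * chi u = phi u * (g * h)).
by rewrite -mulgA (hE u : h * chi u = psi u * h) !mulgA E.
Qed.

Lemma out_inj C D : proj1_sig C = proj1_sig D -> C = D.
Proof.
case: C D => [C hC] [D hD] /= E; move: hC hD; rewrite E => hC hD.
by rewrite (Prop_irrelevance hC hD).
Qed.

Lemma out_repE C : proj1_sig C = out_class (out_rep C).
Proof.
by rewrite /out_rep; case: ClassicalEpsilon.constructive_indefinite_description => phi [].
Qed.

Definition mkout phi (aphi : is_aut phi) : Out n :=
  exist _ (out_class phi) (ex_intro _ phi (conj aphi erefl)).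

Lemma out_rep_mkout phi (aphi : is_aut phi) :
  exists g : FG n, forall u, g * out_rep (mkout aphi) u = phi u * g.
Proof.
have : out_class (out_rep (mkout aphi)) (out_rep (mkout aphi)).
  split; first exact: out_rep_aut.
  by exists 1 => u; change (1 * out_rep (mkout aphi) u = out_rep (mkout aphi) u * 1); rewrite mul1g mulg1.
by rewrite -out_repE => -[_ []] g E; exists g.
Qed.

Lemma mkout_rep C : mkout (out_rep_aut C) = C.
Proof. by apply: out_inj; rewrite [RHS]out_repE. Qed.

(** Products can be computed from any representatives, not only from the chosen [out_rep]; the group
    laws then follow from those of composition. *)
Lemma out_mul_mk phi psi (aphi : is_aut phi) (apsi : is_aut psi) :
  out_mul (mkout aphi) (mkout apsi) = mkout (comp_aut aphi apsi).
Proof.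
apply: out_inj => /=; have [g gE] := out_rep_mkout aphi; have [h hE] := out_rep_mkout apsi.
apply/esym/(@out_class_eq _ _ (phi h * g)) => [||u]; try exact: comp_aut; try exact: comp_aut (out_rep_aut _) (out_rep_aut _).
by rewrite /= -mulgA gE !mulgA -!(aut_morph aphi) hE.
Qed.

Lemma mkout_eq phi psi (aphi : is_aut phi) (apsi : is_aut psi) :
  phi =1 psi -> mkout aphi = mkout apsi.
Proof. by move/funext=> E; apply: out_inj; rewrite /= E. Qed.

Lemma inv_aut phi : is_aut phi -> {psi | is_aut psi & cancel phi psi /\ cancel psi phi}.
Proof.
move=> [hphi bphi]; apply/cid2; case: bphi => psi K1 K2; exists psi => //.
split; last by exists phi.
by move=> u v; apply: (can_inj K1); rewrite hphi !K2.
Qed.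

Definition out_inv C := mkout (s2valP (inv_aut (out_rep_aut C))).

Lemma out_mulA : associative (@out_mul n).
Proof.
move=> C D E; rewrite -(mkout_rep C) -(mkout_rep D) -(mkout_rep E) !out_mul_mk.
exact: mkout_eq.
Qed.

Lemma out_mul1 : left_id (out_one n) (@out_mul n).
Proof.
move=> C; rewrite -(mkout_rep C) (_ : out_one n = mkout (id_aut n)) // out_mul_mk.
exact: mkout_eq.
Qed.

Lemma out_mulV : right_inverse (out_one n) out_inv (@out_mul n).
Proof.
move=> C; rewrite -{1}(mkout_rep C) (_ : out_one n = mkout (id_aut n)) // out_mul_mk.
apply: mkout_eq => u /=; exact: (proj2 (s2valP' (inv_aut (out_rep_aut C)))).
Qed.

End OutGroup.

(** * The action on kernels *)

Section Transvection.
Variables (n : nat) (j : 'I_n).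
Implicit Types a b s : seq (letter n).

Definition avoids s := all (fun x => x.1 != j) s.

Lemma avoids_winv s : avoids (winv s) = avoids s.
Proof. by rewrite /avoids /winv all_rev all_map. Qed.

Lemma avoids_cat s t : avoids (s ++ t) = avoids s && avoids t.
Proof. exact: all_cat. Qed.

Lemma avoids_ev (G : groupType) (h h' : 'I_n -> G) s :
  (forall i, i != j -> h i = h' i) -> avoids s -> ev h s = ev h' s.
Proof. by move=> E /allP avs; apply: eq_in_ev => x /avs/E. Qed.

Definition transv_gen a b i : FG n := if i == j then word a * gen j * word b else gen i.
Definition transv a b (u : FG n) : FG n := ev (transv_gen a b) (val u).

Lemma transv_morph a b : {morph transv a b : u v / u * v}.
Proof. by move=> u v; rewrite /transv ev_mul. Qed.

Lemma transv_genE a b i : transv a b (gen i) = transv_gen a b i.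
Proof. by rewrite /transv ev_gen. Qed.

Lemma transv_word a b s : avoids s -> transv a b (word s) = word s.
Proof.
move=> avs; rewrite /transv ev_wordE -[RHS]ev_word; apply: avoids_ev avs => i /negPf nij.
by rewrite /transv_gen nij.
Qed.

Lemma eq_morph_FG (G : groupType) (f g : FG n -> G) :
  {morph f : u v / u * v} -> {morph g : u v / u * v} ->
  (forall i, f (gen i) = g (gen i)) -> f =1 g.
Proof.
move=> fM gM E u; rewrite (morph_FG u fM) (morph_FG u gM).
by apply: eq_in_ev => x _ /=.
Qed.

Lemma transvK a b : avoids a -> avoids b ->
  cancel (transv (winv a) (winv b)) (transv a b).
Proof.
move=> ava avb; apply: (@eq_morph_FG _ (transv a b \o transv (winv a) (winv b)) id) => //.
  by move=> u v /=; rewrite !transv_morph.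
move=> i /=; rewrite transv_genE /transv_gen; case: (eqVneq i j) => [->|ni].
  rewrite !transv_morph transv_genE /transv_gen eqxx !transv_word ?avoids_winv //.
  by rewrite !word_winv !mulgA mulVg mul1g mulgK.
by rewrite transv_genE /transv_gen (negPf ni).
Qed.

Lemma transv_aut a b : avoids a -> avoids b -> is_aut (transv a b).
Proof.
move=> ava avb; split; first exact: transv_morph.
exists (transv (winv a) (winv b)); last exact: transvK.
have := @transvK (winv a) (winv b); rewrite !winvK !avoids_winv; exact.
Qed.

End Transvection.

Section KernelAction.
Variables (n : nat) (gT : finGroupType).
Local Notation Y := {ffun 'I_n -> gT}.
Implicit Types (h f : Y) (phi psi : FG n -> FG n) (A : {set Y}).

(** Homomorphisms from the free group to [gT] are encoded by their values on the generators; this is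
    the code of [ev h] composed with [phi]. *)
Definition pull phi h : Y := [ffun i => ev h (val (phi (gen i)))].

Lemma ev_pull phi h u : is_aut phi -> ev (pull phi h) (val u) = ev h (val (phi u)).
Proof.
move=> aphi; rewrite (morph_FG (f := fun u => ev h (val (phi u))) u).
  by apply: eq_in_ev => x _ /=; rewrite ffunE.
by move=> v w; rewrite (aut_morph aphi) ev_mul.
Qed.

(* The point of the action given by the kernel of the homomorphism [ev h]. *)
Definition kernel_class h : {set Y} :=
  [set h' : Y | `[< forall u : FG n, ev h (val u) = 1 <-> ev h' (val u) = 1 >]].

Lemma kernel_classP h h' :
  kernel_class h = kernel_class h' <-> forall u : FG n, ev h (val u) = 1 <-> ev h' (val u) = 1.
Proof.
split=> [E|E].
  have : h' \in kernel_class h by rewrite E inE; apply/asboolP.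
  by rewrite inE => /asboolP.
apply/setP => f; rewrite !inE; apply/asboolP/asboolP => F u.
  by split=> [/E/F|/F/E].
by split=> [/E/F|/F/E].
Qed.

Lemma kernel_classP_word h h' :
  (forall s, ev h s = 1 <-> ev h' s = 1) -> kernel_class h = kernel_class h'.
Proof. by move=> E; apply/kernel_classP => u. Qed.

Lemma kernel_class_pull phi h h' : is_aut phi -> kernel_class h = kernel_class h' -> kernel_class (pull phi h) = kernel_class (pull phi h').
Proof. by move=> aphi /kernel_classP E; apply/kernel_classP => u; rewrite !ev_pull. Qed.

(** Extending the action trivially to sets that are not kernel classes gives permutations of a whole
    finite type. *)
Definition kernel_act phi A : {set Y} := if [pick h | A == kernel_class h] is Some h then kernel_class (pull phi h) else A.

Lemma kernel_act_class phi h : is_aut phi -> kernel_act phi (kernel_class h) = kernel_class (pull phi h).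
Proof.
move=> aphi; rewrite /kernel_act; case: pickP => [h' /eqP E|/(_ h)]; last by rewrite eqxx.
by apply: kernel_class_pull.
Qed.

Lemma kernel_act_id phi A : (forall h, A != kernel_class h) -> kernel_act phi A = A.
Proof. by move=> nA; rewrite /kernel_act; case: pickP => // h; rewrite (negPf (nA h)). Qed.

(** Pulling back is contravariant, so this is a right action, which agrees with the left-to-right
    product of permutations. *)
Lemma kernel_act_comp phi psi A : is_aut phi -> is_aut psi -> kernel_act psi (kernel_act phi A) = kernel_act (phi \o psi) A.
Proof.
move=> aphi apsi; have [[h ->]|nA] := pselect (exists h, A = kernel_class h).
  rewrite !kernel_act_class //; last exact: comp_aut.
  by congr kernel_class; apply/ffunP => i; rewrite !ffunE ev_pull.
by rewrite !kernel_act_id // => h; apply/eqP => E; apply: nA; exists h.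
Qed.

(** Kernels are normal, so inner automorphisms fix every point and the action descends to
    Out(F_n). *)
Lemma kernel_act_inner phi psi (g : FG n) A : is_aut phi -> is_aut psi ->
  (forall u, g * psi u = phi u * g) -> kernel_act psi A = kernel_act phi A.
Proof.
move=> aphi apsi E; have [[h ->]|nA] := pselect (exists h, A = kernel_class h).
  rewrite !kernel_act_class //; apply/kernel_classP => u; rewrite !ev_pull //.
  have /(congr1 (fun v : FG n => ev h (val v))) := E u; rewrite !ev_mul => H.
  split=> e1; move: H; rewrite e1 ?mulg1 ?mul1g.
    by rewrite -[LHS]mul1g => /mulIg.
  by rewrite -[RHS]mulg1 => /mulgI.
by rewrite !kernel_act_id // => h; apply/eqP => F; apply: nA; exists h.
Qed.

Lemma kernel_act_inj phi : is_aut phi -> injective (kernel_act phi).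
Proof.
move=> aphi; have [psi apsi [_ K]] := inv_aut aphi.
apply: (can_inj (g := kernel_act psi)) => A; rewrite kernel_act_comp //.
have -> : phi \o psi = id by apply/funext => u /=.
have [[h ->]|nA] := pselect (exists h, A = kernel_class h).
  rewrite kernel_act_class; last exact: id_aut.
  by congr kernel_class; apply/ffunP => i; rewrite ffunE ev_gen.
by rewrite !kernel_act_id // => h; apply/eqP => E; apply: nA; exists h.
Qed.

Definition kernel_perm (C : Out n) : {perm {set Y}} := perm (kernel_act_inj (out_rep_aut C)).

Lemma kernel_perm_mk phi (aphi : is_aut phi) A : kernel_perm (mkout aphi) A = kernel_act phi A.
Proof.
by rewrite permE; have [g gE] := out_rep_mkout aphi; apply: kernel_act_inner gE => //; apply: out_rep_aut.
Qed.

Lemma kernel_permM C D : kernel_perm (out_mul C D) = kernel_perm C * kernel_perm D.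
Proof.
rewrite -(mkout_rep C) -(mkout_rep D) out_mul_mk; apply/permP => A.
by rewrite permM !kernel_perm_mk kernel_act_comp //; apply: out_rep_aut.
Qed.

Definition kernel_image := [set q | `[< exists C, kernel_perm C = q >]].

Lemma kernel_image_group : group_set kernel_image.
Proof.
apply/group_setP; split=> [|_ _ /[!inE] /asboolP[C <-] /asboolP[D <-]]; last first.
  by apply/asboolP; exists (out_mul C D); rewrite kernel_permM.
rewrite inE; apply/asboolP; exists (out_one n).
by apply: (mulgI (kernel_perm (out_one n))); rewrite -kernel_permM out_mul1 mulg1.
Qed.

Hypotheses (simT : simple [set: gT]) (cT : 'Z([set: gT]) = 1).
Variable sg : gT.
Hypotheses (sg1 : sg != 1) (sg2 : sg * sg = 1).
Variables (j : 'I_n) (f : Y).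
Hypothesis genf : forall a, exists2 s, avoids j s & ev f s = a.

(** The kernel of h on the free factor A of words avoiding j is not contained in that of f. When it
    is contained, the two kernels on A coincide, since f maps A onto the whole of [gT]. *)
Definition ker_off h := exists2 u, avoids j u & ev h u = 1 /\ ev f u <> 1.

(** Induction on a list of tuples h to be killed. The attainable values form a normal subgroup U, so
    by simplicity a nontrivial value suffices. If u is killed by [h0] but not by f, its commutator
    with a word killed by the earlier tuples is killed by all; as the centre is trivial, its value
    under f can be made nontrivial. *)
Lemma separating_word a :
  exists2 s, avoids j s & ev f s = a /\ forall h, ker_off h -> ev h s = 1.
Proof.
suff H (hs : seq Y) : forall b, exists2 s, avoids j s & ev f s = b /\
    forall h, h \in hs -> ker_off h -> ev h s = 1.
  have [s avs [fs hs]] := H (enum Y) a; exists s => //; split=> // h.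
  by apply: hs; rewrite mem_enum.
elim: hs => [|h0 hs IH] b; first by have [s avs fs] := genf b; exists s.
pose U := [set b | `[< exists2 s, avoids j s & ev f s = b /\
    forall h, h \in h0 :: hs -> ker_off h -> ev h s = 1 >]].
suff UT : U = [set: gT].
  by have := in_setT b; rewrite -UT inE => /asboolP.
have gU : group_set U.
  apply/group_setP; split=> [|c d]; rewrite !inE.
    by apply/asboolP; exists [::]; rewrite ?ev_nil; split=> // h _ _; rewrite ev_nil.
  move=> /asboolP[s avs [fs hsE]] /asboolP[t avt [ft htE]]; apply/asboolP; exists (s ++ t).
    by rewrite avoids_cat avs.
  by rewrite ev_cat fs ft; split=> // h hin hoff; rewrite ev_cat hsE ?htE ?mulg1.
have nU : Group gU <| [set: gT].
  rewrite /normal subsetT; apply/subsetP => c _; rewrite inE; apply/subsetP => _ /imsetP[d dU ->].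
  move: dU; rewrite !inE => /asboolP[s avs [fs hsE]]; have [t avt ft] := genf c.
  apply/asboolP; exists (winv t ++ s ++ t); first by rewrite !avoids_cat avoids_winv avt avs.
  rewrite !ev_cat ev_winv fs ft; split=> // h hin hoff.
  by rewrite !ev_cat ev_winv hsE // mul1g mulVg.
have /simpleP[_ /(_ _ nU) [U1|//]] := simT.
suff [c cU c1] : exists2 c, c \in U & c != 1 by move: c1; rewrite -in_set1 -[[set 1]]U1 cU.
have [[u avu [hu fu]]|noff] := pselect (ker_off h0); last first.
  exists sg => //; rewrite inE; have [s avs [fs hsE]] := IH sg; apply/asboolP; exists s => //.
  by split=> // h; rewrite inE => /orP[/eqP ->|]; [| exact: hsE].
have [c cn] : exists c, ~ commute (ev f u) c.
  apply/existsNP => cc; apply: fu; apply/set1P; rewrite -[[set 1]]cT.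
  by apply/centerP; split=> // c _; apply: cc.
have [s avs [fs hsE]] := IH c; exists [~ ev f u, c]; last by apply/commgP.
rewrite inE; apply/asboolP; exists (winv u ++ winv s ++ u ++ s).
  by rewrite !avoids_cat !avoids_winv avu avs.
split=> [|h]; first by rewrite !ev_cat !ev_winv fs.
rewrite !ev_cat !ev_winv inE => /orP[/eqP -> _|hin hoff].
  by rewrite hu invg1 !mul1g mulVg.
by rewrite (hsE _ hin hoff) invg1 mul1g mulg1 mulVg.
Qed.

Definition upd t : Y := [ffun i => if i == j then t else f i].

Lemma upd_ev t s : avoids j s -> ev (upd t) s = ev f s.
Proof. by apply: avoids_ev => i /negPf ni; rewrite ffunE ni. Qed.

Definition subst_word u s := flatten [seq if x.1 == j then (if x.2 then winv u else u) else [:: x] | x <- s].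

Lemma avoids_subst u s : avoids j u -> avoids j (subst_word u s).
Proof.
move=> avu; elim: s => [|x s IH] //; rewrite /subst_word /= avoids_cat IH andbT.
by case: eqVneq => [_|ni]; [case: x.2; rewrite ?avoids_winv | rewrite /avoids /= ni].
Qed.

Lemma ev_subst (h : Y) u s : h j = ev h u -> ev h (subst_word u s) = ev h s.
Proof.
move=> E; elim: s => [|x s IH] //; rewrite /subst_word /= ev_cat IH ev_cons; congr (_ * _).
rewrite /lval; case: eqVneq => [->|_]; last by rewrite ev_cons ev_nil mulg1.
by case: x.2; rewrite ?ev_winv E.
Qed.

(** A pigeonhole argument: sending f(u) to h(u), for u avoiding j, is an injection of [gT] into
    itself, hence a bijection. So h maps x_j to the value of some u avoiding j, and replacing x_j by
    u reduces the comparison of kernels to words avoiding j. *)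
Lemma ker_on_upd h : ~ ker_off h -> exists t, kernel_class h = kernel_class (upd t).
Proof.
move=> noff; have sub u : avoids j u -> ev h u = 1 -> ev f u = 1.
  by move=> avu hu; apply: contrapT => fu; apply: noff; exists u.
have /choice[c cE] : forall a, exists s, avoids j s /\ ev f s = a.
  by move=> a; have [s] := genf a; exists s.
have eqf u v : avoids j u -> avoids j v -> ev h u = ev h v -> ev f u = ev f v.
  move=> avu avv E; apply: (mulgI (ev f v)^-1); rewrite mulVg -ev_winv -ev_cat.
  apply: sub; first by rewrite avoids_cat avoids_winv avu avv.
  by rewrite ev_cat ev_winv E mulVg.
have ci : injective (fun a => ev h (c a)).
  by move=> a b E; have [ava <-] := cE a; have [avb <-] := cE b; apply: eqf.
have [g _ gK] := injF_bij ci.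
have eqh u v : avoids j u -> avoids j v -> ev f u = ev f v -> ev h u = ev h v.
  have H w : avoids j w -> ev h w = ev h (c (ev f w)).
    move=> avw; rewrite -{1}(gK (ev h w)) /=; congr (ev h (c _)).
    have [av <-] := cE (g (ev h w)); apply: eqf => //; exact: gK.
  by move=> avu avv E; rewrite H // [RHS]H // E.
pose u := c (g (h j)).
have [avu fu] : avoids j u /\ ev f u = g (h j) by apply: cE.
have hu : h j = ev h u by rewrite -[LHS]gK.
exists (ev f u); apply: kernel_classP_word => s.
have uu : upd (ev f u) j = ev (upd (ev f u)) u by rewrite upd_ev // ffunE eqxx.
rewrite -(ev_subst _ hu) -[ev (upd _) s](ev_subst _ uu) upd_ev ?avoids_subst //.
split=> [|E]; first by apply: sub; apply: avoids_subst.
by rewrite (eqh _ [::]) ?ev_nil ?avoids_subst.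
Qed.

(** If u avoids j and f(u) = s, then [upd r] kills the word u^-1 x_j exactly when r = s. *)
Lemma upd_inj : injective (fun t => kernel_class (upd t)).
Proof.
move=> s t /kernel_classP E; have [u avu fu] := genf s.
have ux r : ev (upd r) (val (word (winv u ++ [:: (j, false)]))) = s^-1 * r.
  by rewrite ev_wordE ev_cat ev_winv upd_ev // fu ev_cons ev_nil mulg1 /lval /= ffunE eqxx.
have [/(_ _)] := E (word (winv u ++ [:: (j, false)])).
rewrite !ux mulVg => /(_ erefl) H _.
by apply: (mulgI s^-1); rewrite mulVg H.
Qed.

(** The transvection by separating words for a and b acts as the translation on the classes of the
    [upd t]. By [ker_on_upd], any other kernel class comes from a tuple with [ker_off], which kills
    both words and so is not changed at all. *)
Lemma upd_mul a b : exists2 q, q \in kernel_image &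
  (forall t, q (kernel_class (upd t)) = kernel_class (upd (a * t * b))) /\
  (forall A, A \notin codom (fun t => kernel_class (upd t)) -> q A = A).
Proof.
have [s avs [fs sE]] := separating_word a; have [r avr [fr rE]] := separating_word b.
have atr := transv_aut avs avr.
exists (kernel_perm (mkout atr)); first by rewrite inE; apply/asboolP; eexists.
have pullE h i : pull (transv j s r) h i = if i == j then ev h s * h j * ev h r else h i.
  rewrite ffunE transv_genE /transv_gen; case: (i == j); last by rewrite ev_gen.
  by rewrite !ev_mul !ev_wordE ev_gen.
split=> [t|A nA]; rewrite kernel_perm_mk.
  rewrite kernel_act_class //; congr kernel_class; apply/ffunP => i; rewrite pullE !upd_ev // fs fr !ffunE eqxx.
  by case: (i == j).
have [[h AE]|noA] := pselect (exists h, A = kernel_class h); last first.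
  by apply: kernel_act_id => h; apply/eqP => E; apply: noA; exists h.
rewrite AE kernel_act_class //; congr kernel_class; apply/ffunP => i; rewrite pullE.
have [hoff|non] := pselect (ker_off h); last first.
  have [t hE] := ker_on_upd non; case/negP: nA; rewrite AE hE; exact: codom_f.
by rewrite sE // rE // mul1g mulg1; case: eqP => [->|].
Qed.

(** The permutation given by C lies in Phi(Q), and so does its conjugate by that of [theta]. This
    conjugate fixes the class of f, which is [upd (f j)]; hence C fixes the class of f composed with
    [theta]. *)
Lemma frattini_f_kernel (C : Out n) theta (u : FG n) :
  frattini_f (@out_mul n) (out_one n) C -> is_aut theta ->
  ev f (val (theta u)) = 1 -> ev f (val (theta (out_rep C u))) = 1.
Proof.
move=> fC ath.
pose Q := Group kernel_image_group.
have kQ q : q \in Q <-> exists D, kernel_perm D = q by rewrite inE; split=> /asboolP.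
have fkQ : kernel_perm C \in 'Phi(Q).
  exact: (frattini_f_image (@out_mulA n) (@out_mul1 n) (@out_mulV n) kernel_permM kQ fC).
have lft a : exists2 q, q \in Q & (forall t, q (kernel_class (upd t)) = kernel_class (upd (a * t))) /\
    (forall A, A \notin codom (fun t => kernel_class (upd t)) -> q A = A).
  by have [q qQ [q1 q2]] := upd_mul a 1; exists q => //; split=> // t; rewrite q1 mulg1.
have rgt a : exists2 q, q \in Q & (forall t, q (kernel_class (upd t)) = kernel_class (upd (t * a))) /\
    (forall A, A \notin codom (fun t => kernel_class (upd t)) -> q A = A).
  by have [q qQ [q1 q2]] := upd_mul 1 a; exists q => //; split=> // t; rewrite q1 mul1g.
have fixP := nilpotent_normal_fix upd_inj simT cT sg1 sg2 lft rgt (Phi_normal Q) (Phi_nilpotent Q).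
have fE : upd (f j) = f by apply/ffunP => i; rewrite ffunE; case: eqP => [->|].
have qQ : kernel_perm (mkout ath) \in Q by apply/kQ; exists (mkout ath).
have : kernel_perm C ^ (kernel_perm (mkout ath))^-1 \in 'Phi(Q).
  by rewrite memJ_norm ?groupV // (subsetP (normal_norm (Phi_normal Q))).
move=> /(fixP _ (f j)); rewrite /= fE conjgE invgK !permM => /(canRL (permKV _)).
rewrite kernel_perm_mk -(mkout_rep C) kernel_perm_mk !kernel_act_class //; try exact: out_rep_aut.
move/kernel_classP/(_ u); rewrite !ev_pull ?mkout_rep //; try exact: out_rep_aut.
by move=> [_ H] /H.
Qed.
End KernelAction.

(** * The groups SL(2,F) and PSL(2,F) *)

Local Open Scope ring_scope.

Section Mx2.
Variable R : comNzRingType.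
Implicit Types (a b c d : R) (M : 'M[R]_2).

Definition mx2 a b c d : 'M[R]_2 :=
  \matrix_(i, j) (if i == 0 then if j == 0 then a else b else if j == 0 then c else d).

Lemma mx2E a b c d : ((mx2 a b c d 0 0 = a) * (mx2 a b c d 0 1 = b) *
  (mx2 a b c d 1 0 = c) * (mx2 a b c d 1 1 = d))%type.
Proof. by rewrite !mxE. Qed.

Lemma eq_mx2 M M' : M 0 0 = M' 0 0 -> M 0 1 = M' 0 1 -> M 1 0 = M' 1 0 -> M 1 1 = M' 1 1 -> M = M'.
Proof.
move=> h00 h01 h10 h11; apply/matrixP => i j.
have E (k : 'I_2) : (k == 0) || (k == 1) by case: k => -[|[|]].
by case/orP: (E i) => /eqP ->; case/orP: (E j) => /eqP ->.
Qed.

Lemma mx2_eta M : M = mx2 (M 0 0) (M 0 1) (M 1 0) (M 1 1).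
Proof. by apply: eq_mx2; rewrite mx2E. Qed.

Lemma sum2 (F : 'I_2 -> R) : \sum_i F i = F 0 + F 1.
Proof. by rewrite big_ord_recl big_ord1; congr (_ + F _); apply: val_inj. Qed.

Lemma mul_mx2 a b c d a' b' c' d' : mx2 a b c d *m mx2 a' b' c' d' =
  mx2 (a * a' + b * c') (a * b' + b * d') (c * a' + d * c') (c * b' + d * d').
Proof. by apply: eq_mx2; rewrite !mxE sum2 !mxE. Qed.

Lemma tr_mx2 a b c d : \tr (mx2 a b c d) = a + d.
Proof. by rewrite /mxtrace sum2 !mx2E. Qed.

Lemma det_mx2 a b c d : \det (mx2 a b c d) = a * d - b * c.
Proof.
rewrite (expand_det_row _ 0) sum2 /cofactor !det_mx11 !mxE /= expr0 expr1.
by rewrite mul1r mulN1r mulrN.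
Qed.

Lemma mx2_scalar a : a%:M = mx2 a 0 0 a.
Proof. by apply: eq_mx2; rewrite mx2E !mxE //= ?mulr1n ?mulr0n. Qed.

Lemma mx2_1 : 1%:M = mx2 1 0 0 1.
Proof. exact: mx2_scalar. Qed.

End Mx2.

Section SL2.
Variable F : finFieldType.

Definition sl2 := {M : 'M[F]_2 | \det M == 1}.
HB.instance Definition _ := Finite.copy sl2 {M : 'M[F]_2 | \det M == 1}.

Lemma sl2_det (x : sl2) : \det (val x) = 1. Proof. exact: eqP (valP x). Qed.

Lemma sl2_mulP (x y : sl2) : \det (val x *m val y) == 1.
Proof. by rewrite det_mulmx !sl2_det mulr1. Qed.
Lemma sl2_oneP : \det (1%:M : 'M[F]_2) == 1.
Proof. by rewrite det1. Qed.
Lemma sl2_invP (x : sl2) : \det (\adj (val x)) == 1.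
Proof.
have /(congr1 determinant) := mul_mx_adj (val x).
by rewrite det_mulmx sl2_det det1 mul1r => ->.
Qed.

Definition sl2_mul (x y : sl2) : sl2 := Sub (val x *m val y) (sl2_mulP x y).
Definition sl2_one : sl2 := Sub 1%:M sl2_oneP.
Definition sl2_inv (x : sl2) : sl2 := Sub (\adj (val x)) (sl2_invP x).

Lemma sl2_mulA : associative sl2_mul.
Proof. by move=> x y z; apply: val_inj; rewrite /= mulmxA. Qed.
Lemma sl2_mul1 : left_id sl2_one sl2_mul.
Proof. by move=> x; apply: val_inj; rewrite /= mul1mx. Qed.
Lemma sl2_mulV : left_inverse sl2_one sl2_inv sl2_mul.
Proof. by move=> x; apply: val_inj; rewrite /= mul_adj_mx sl2_det. Qed.

HB.instance Definition _ := Finite_isGroup.Build sl2 sl2_mulA sl2_mul1 sl2_mulV.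

Implicit Types x y : sl2.

Lemma val_sl2M x y : val (x * y)%g = val x *m val y. Proof. by []. Qed.
Lemma val_sl2_1 : val (1%g : sl2) = mx2 1 0 0 1. Proof. exact: mx2_1. Qed.

(** The default value of [insubd] keeps determinant proofs out of the terms; they reappear as side
    conditions of the computation rules. *)
Definition sl2_mx (a b c d : F) : sl2 := insubd (1%g : sl2) (mx2 a b c d).
Arguments sl2_mx (a b c d)%_ring_scope.
Lemma val_sl2_mx a b c d : a * d - b * c = 1 -> val (sl2_mx a b c d) = mx2 a b c d.
Proof. by move=> E; rewrite insubdK // -topredE /= det_mx2 E. Qed.

Lemma sl2P x : {q : F * F * F * F | let: (a, b, c, d) := q in a * d - b * c = 1 /\ x = sl2_mx a b c d}.
Proof.
exists (val x 0 0, val x 0 1, val x 1 0, val x 1 1).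
have E : val x 0 0 * val x 1 1 - val x 0 1 * val x 1 0 = 1.
  by rewrite -det_mx2 -mx2_eta sl2_det.
by split=> //; apply: val_inj; rewrite val_sl2_mx // -mx2_eta.
Qed.

Lemma sl2_mxM a b c d a' b' c' d' : a * d - b * c = 1 -> a' * d' - b' * c' = 1 ->
  (sl2_mx a b c d * sl2_mx a' b' c' d')%g =
  sl2_mx (a * a' + b * c') (a * b' + b * d') (c * a' + d * c') (c * b' + d * d').
Proof.
move=> E E'; apply: val_inj; rewrite val_sl2M !val_sl2_mx ?mul_mx2 //.
by rewrite -[1]mulr1 -{1}E -E'; ring.
Qed.

Lemma sl2_mx1 : 1%g = sl2_mx 1 0 0 1.
Proof. by apply: val_inj; rewrite val_sl2_1 val_sl2_mx // mulr1 mulr0 subr0. Qed.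

Lemma sl2_mxV a b c d : a * d - b * c = 1 -> ((sl2_mx a b c d)^-1)%g = sl2_mx d (- b) (- c) a.
Proof.
move=> E; apply: (mulgI (sl2_mx a b c d)); rewrite mulgV sl2_mxM //; last by rewrite -E; ring.
rewrite sl2_mx1; congr sl2_mx; rewrite -?E; ring.
Qed.

Lemma sl2_mx_inj a b c d a' b' c' d' : a * d - b * c = 1 -> a' * d' - b' * c' = 1 ->
  sl2_mx a b c d = sl2_mx a' b' c' d' -> [/\ a = a', b = b', c = c' & d = d'].
Proof.
move=> E E' /(congr1 val); rewrite !val_sl2_mx // => M.
by split; [move/matrixP/(_ 0 0): M|move/matrixP/(_ 0 1): M|move/matrixP/(_ 1 0): M|move/matrixP/(_ 1 1): M]; rewrite !mx2E.
Qed.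

Definition elX a := sl2_mx 1 a 0 1.
Definition elY a := sl2_mx 1 0 a 1.

Arguments elX a%_ring_scope.
Arguments elY a%_ring_scope.

Lemma detX (a : F) : 1 * 1 - a * 0 = 1. Proof. by rewrite mulr0 subr0 mulr1. Qed.
Lemma detY (a : F) : 1 * 1 - 0 * a = 1. Proof. by rewrite mul0r subr0 mulr1. Qed.

Lemma elXD a b : (elX a * elX b)%g = elX (a + b).
Proof. by rewrite sl2_mxM ?detX //; congr sl2_mx; ring. Qed.
(** For c nonzero the matrix is a product of the form X Y X. For c = 0 the entry a is nonzero, and
    adding the first row to the second reduces to that case. *)
Lemma mem_sl2_mx (K : {group sl2}) (a b c d : F) : a * d - b * c = 1 ->
  (forall u, elX u \in K) -> (forall u, elY u \in K) -> sl2_mx a b c d \in K.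
Proof.
move=> E KX KY.
have gen_nz (a' b' c' d' : F) : c' != 0 -> a' * d' - b' * c' = 1 -> sl2_mx a' b' c' d' \in K.
  move=> c0 E'; have -> : sl2_mx a' b' c' d' = (elX ((a' - 1) / c') * elY c' * elX ((d' - 1) / c'))%g.
    have bE : b' = (a' * d' - 1) / c' by rewrite -E'; field.
    rewrite !sl2_mxM ?detX ?detY //; last by field.
    by rewrite bE; congr sl2_mx; field.
  by rewrite !groupM.
have [c0|c0] := eqVneq c 0; last exact: gen_nz.
have a0 : a != 0 by apply: contra_eq_neq E => ->; rewrite c0 mul0r mulr0 subr0 eq_sym oner_eq0.
have E2 : a * (b + d) - b * (a + c) = 1 by rewrite -E; ring.
have -> : sl2_mx a b c d = (elY (- 1) * sl2_mx a b (a + c) (b + d))%g.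
  by rewrite sl2_mxM ?detY //; congr sl2_mx; ring.
by apply: groupM; [apply: KY | apply: gen_nz; rewrite ?c0 ?addr0 // -[d]addr0 -E2 c0; ring].
Qed.

Lemma sl2_centerP x : reflect (exists2 a, a * a = 1 & x = sl2_mx a 0 0 a) (x \in 'Z([set: sl2])%g).
Proof.
apply: (iffP (centerP _ _)) => [[_ cx]|[a a1 ->]]; last first.
  split=> [|y _]; first exact: in_setT.
  have [[[[p q] r] s] [E ->]] := sl2P y.
  by rewrite /commute !sl2_mxM ?mul0r ?subr0 //; congr sl2_mx; ring.
have [[[[a b] c] d] [E xE]] := sl2P x.
have /(congr1 val) := cx (elX 1) (in_setT _).
rewrite xE !val_sl2M !val_sl2_mx ?detX // !mul_mx2 => /matrixP M.
have /(congr1 val) := cx (elY 1) (in_setT _).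
rewrite xE !val_sl2M !val_sl2_mx ?detY // !mul_mx2 => /matrixP N.
move: (M 0 0) (M 0 1) (N 0 0); rewrite !mx2E !mul1r !mulr1 !mulr0 !mul0r !addr0 => c0 ad b0.
have {}c0 : c = 0 by apply: (addrI a); rewrite -c0 addr0.
have {}b0 : b = 0 by apply: (addrI a); rewrite b0 addr0.
have {}ad : d = a by move: ad; rewrite b0 addr0 add0r.
by exists a; [move: E; rewrite ad b0 mul0r subr0 | rewrite b0 c0 ad].
Qed.

Hypothesis F30 : 30%:R != 0 :> F.

Let F2 : 2%:R != 0 :> F.
Proof. by apply: contraNneq F30 => E; rewrite (natrM _ 2 15) E mul0r. Qed.

Let F4 : 4%:R != 0 :> F.
Proof. by rewrite (natrM _ 2 2) mulf_neq0. Qed.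

Let F16 : 16%:R != 0 :> F.
Proof. by rewrite (natrM _ 4 4) mulf_neq0. Qed.

(** Conjugation by diagonal matrices multiplies a by squares. In odd characteristic every element is
    a difference of two squares, here with s + t = u/a and s - t = 1, so K contains all [elX u], and
    all [elY u] by a quarter turn. *)
Lemma normal_elX (K : {group sl2}) (a : F) : (K <| [set: sl2])%g -> a != 0 ->
  elX a \in K -> K = [set: sl2] :> {set sl2}.
Proof.
move=> nK a0 Xa.
have KJ x y : x \in K -> (x ^ y)%g \in K.
  by move=> xK; rewrite memJ_norm // (subsetP (normal_norm nK)) ?in_setT.
have KX u : elX u \in K.
  have Xs s : s != 0 -> elX (a * s ^+ 2) \in K.
    move=> s0; have E : s^-1 * s - 0 * 0 = 1 by rewrite mulVf // mul0r subr0.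
    suff <- : (elX a ^ sl2_mx s^-1 0 0 s)%g = elX (a * s ^+ 2) by apply: KJ.
    rewrite conjgE sl2_mxV // !sl2_mxM ?detX //; try by field.
    by congr sl2_mx; field.
  pose s := (u / a + 1) / 2%:R; pose t := (u / a - 1) / 2%:R.
  have uE : u = a * s ^+ 2 - a * t ^+ 2 by rewrite /s /t; field; rewrite ?c0 ?a0 ?F2 ?F4 ?F16.
  have XN v : elX v \in K -> elX (- v) \in K.
    have <- : ((elX v)^-1)%g = elX (- v) by rewrite sl2_mxV ?detX // oppr0.
    by rewrite groupV.
  have Xs' v : elX (a * v ^+ 2) \in K.
    have [->|/Xs //] := eqVneq v 0; rewrite expr0n mulr0.
    by have := group1 K; rewrite sl2_mx1.
  by rewrite uE -elXD groupM // XN.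
have KY u : elY u \in K.
  have E : 0 * 0 - (- 1) * 1 = 1 :> F by ring.
  suff <- : (elX (- u) ^ sl2_mx 0 (- 1) 1 0)%g = elY u by apply: KJ.
  rewrite conjgE sl2_mxV // !sl2_mxM ?detX //; try by ring.
  by congr sl2_mx; ring.
apply/setP => x; rewrite in_setT; have [[[[p q] r] s] [E ->]] := sl2P x.
exact: mem_sl2_mx.
Qed.

(** For c nonzero, x is conjugated to have upper left entry 0. Its commutator with the diagonal
    matrix of 2 and 1/2 is lower triangular with diagonal 4, 1/4, and the commutator of that with
    [elY 1] is a nontrivial [elY]. The case b nonzero follows by a quarter turn, and a noncentral
    diagonal matrix has a nontrivial commutator with [elX 1]. *)
Lemma normal_sl2 (K : {group sl2}) x : (K <| [set: sl2])%g -> x \in K ->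
  x \notin 'Z([set: sl2])%g -> K = [set: sl2] :> {set sl2}.
Proof.
move=> nK.
have KJ y z : y \in K -> (y ^ z)%g \in K.
  by move=> yK; rewrite memJ_norm // (subsetP (normal_norm nK)) ?in_setT.
have dJ : 0 * 0 - (- 1) * 1 = 1 :> F by ring.
(* conjugation by the quarter turn swaps upper and lower triangular matrices *)
have KY a : a != 0 -> elY a \in K -> K = [set: sl2] :> {set sl2}.
  move=> a0 Ya; apply: (@normal_elX _ (- a)) => //; first by rewrite oppr_eq0.
  suff <- : (elY a ^ sl2_mx 0 (- 1) 1 0)%g = elX (- a) by apply: KJ.
  rewrite conjgE sl2_mxV // !sl2_mxM ?detY //; try by ring.
  by congr sl2_mx; ring.
have Kc (a b c d : F) : c != 0 -> a * d - b * c = 1 -> sl2_mx a b c d \in K -> K = [set: sl2] :> {set sl2}.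
  move=> c0 E xK.
  pose t := a + d.
  have E' : 0 * t - (- c^-1) * c = 1 by field.
  have bE : b = (a * d - 1) / c by rewrite -E; field.
  have x1K : sl2_mx 0 (- c^-1) c t \in K.
    suff <- : (sl2_mx a b c d ^ elX (a / c))%g = sl2_mx 0 (- c^-1) c t by apply: KJ.
    rewrite conjgE sl2_mxV ?detX // !sl2_mxM ?detX // ?bE; try by field.
    by congr sl2_mx; rewrite /t; field.
  have dD : 2%:R * 2%:R^-1 - 0 * 0 = 1 :> F by rewrite mulfV // mul0r subr0.
  pose k := c * t * ((2%:R ^+ 2)^-1 - 1).
  have dk : 2%:R ^+ 2 * (2%:R ^+ 2)^-1 - 0 * k = 1 by rewrite mulfV ?mul0r ?subr0 ?expf_neq0.
  have kK : sl2_mx (2%:R ^+ 2) 0 k (2%:R ^+ 2)^-1 \in K.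
    suff <- : (sl2_mx 0 (- c^-1) c t ^ (sl2_mx 2%:R 0 0 2%:R^-1)^-1 * (sl2_mx 0 (- c^-1) c t)^-1)%g =
        sl2_mx (2%:R ^+ 2) 0 k (2%:R ^+ 2)^-1 by rewrite groupM ?groupV ?KJ.
    rewrite conjgE invgK !sl2_mxV // !sl2_mxM //; try by field; rewrite ?c0 ?a0 ?F2 ?F4 ?F16.
    by congr sl2_mx; rewrite /k; field; rewrite ?c0 ?a0 ?F2 ?F4 ?F16.
  (* This is -15/16, nonzero because 30 is nonzero in F. *)
  apply: (KY ((2%:R ^+ 4)^-1 - 1)).
    rewrite (_ : _ - 1 = - 15%:R * (2%:R ^+ 4)^-1); last by field; rewrite ?F2 ?F16.
    rewrite mulf_neq0 ?invr_eq0 ?expf_neq0 // oppr_eq0.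
    by apply: contraNneq F30 => E15; rewrite (natrM _ 2 15) E15 mulr0.
  suff <- : (sl2_mx (2%:R ^+ 2) 0 k (2%:R ^+ 2)^-1 * (sl2_mx (2%:R ^+ 2) 0 k (2%:R ^+ 2)^-1)^-1 ^ (elY 1)^-1)%g =
      elY ((2%:R ^+ 4)^-1 - 1) by rewrite groupM ?KJ ?groupV.
  rewrite conjgE invgK !sl2_mxV ?detY // !sl2_mxM ?detY //; try by field; rewrite ?c0 ?a0 ?F2 ?F4 ?F16.
  by congr sl2_mx; field; rewrite ?c0 ?a0 ?F2 ?F4 ?F16.
have [[[[a b] c] d] [E ->]] := sl2P x => xK nC.
have [c0|c0] := eqVneq c 0; last exact: Kc E xK.
have ad : a * d = 1 by rewrite -E c0 mulr0 subr0.
have [b0|b0] := eqVneq b 0; last first.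
  apply: (@Kc d (- c) (- b) a); rewrite ?oppr_eq0 //; first by rewrite -E; ring.
  suff <- : (sl2_mx a b c d ^ sl2_mx 0 (- 1) 1 0)%g = sl2_mx d (- c) (- b) a by apply: KJ.
  rewrite conjgE sl2_mxV // !sl2_mxM //; [|by ring|by rewrite -[RHS]E; ring].
  by congr sl2_mx; ring.
apply: (@normal_elX K (a * a - 1) nK).
  rewrite subr_eq0; apply: contraNneq nC => aa; apply/sl2_centerP; exists a => //.
  by rewrite b0 c0; congr sl2_mx; rewrite -[d]mul1r -aa -mulrA ad mulr1.
suff <- : (sl2_mx a b c d * (sl2_mx a b c d)^-1 ^ (elX 1)^-1)%g = elX (a * a - 1).
  by rewrite groupM ?KJ ?groupV.
have a0 : a != 0 by apply: contra_eq_neq ad => ->; rewrite mul0r eq_sym oner_eq0.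
have dE : d = a^-1 by rewrite -[d]mul1r -(mulVf a0) -mulrA ad mulr1.
rewrite b0 c0 dE in E *.
rewrite conjgE invgK !sl2_mxV ?detX // !sl2_mxM ?detX //; try by field.
by congr sl2_mx; field.
Qed.

End SL2.
Arguments sl2_mx [F] (a b c d)%_ring_scope.
Arguments elX [F] a%_ring_scope.
Arguments elY [F] a%_ring_scope.

Section PSL2.
Variable F : finFieldType.
Hypothesis F30 : 30%:R != 0 :> F.
Local Notation Z := ('Z([set: sl2 F])%G).
Implicit Types x y : sl2 F.

Definition psl2 := coset_of Z.
HB.instance Definition _ := FinGroup.on psl2.

Definition psl2_proj x : psl2 := coset Z x.

Lemma norm_center x : x \in 'N(Z)%g.
Proof. by rewrite (subsetP (normal_norm (center_normal _))) ?in_setT. Qed.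

Lemma psl2_projM : {morph psl2_proj : x y / (x * y)%g}.
Proof. by move=> x y; rewrite /psl2_proj morphM ?norm_center. Qed.

Lemma psl2_proj_eq1 x : (psl2_proj x = 1%g) <-> x \in Z.
Proof.
split=> [/(coset_idr (norm_center x)) //|xZ].
exact: coset_id.
Qed.

Lemma psl2_proj_surj (a : psl2) : exists x, psl2_proj x = a.
Proof. by exists (repr a); rewrite /psl2_proj coset_reprK. Qed.

Lemma psl2_normal (K : {group psl2}) x : (K <| [set: psl2])%g -> psl2_proj x \in K ->
  x \notin Z -> K = [set: psl2] :> {set psl2}.
Proof.
move=> nK xK nx.
have nP : (coset Z @*^-1 K <| [set: sl2 F])%g.
  have -> : [set: sl2 F] = (coset Z @*^-1 [set: psl2])%g.
    by apply/setP => y; rewrite in_setT; apply/esym; rewrite mem_morphpre ?norm_center ?in_setT.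
  by rewrite cosetpre_normal.
have PT : (coset Z @*^-1 K)%G = [set: sl2 F] :> {set sl2 F}.
  apply: (@normal_sl2 _ F30 (coset Z @*^-1 K)%G x) => //.
  by rewrite mem_morphpre ?norm_center.
apply/setP => a; rewrite in_setT; have [y <-] := psl2_proj_surj a.
have : y \in (coset Z @*^-1 K)%G by rewrite PT in_setT.
by case/morphpreP.
Qed.

Let F2 : 2%:R != 0 :> F.
Proof. by apply: contraNneq F30 => E; rewrite (natrM _ 2 15) E mul0r. Qed.

Lemma elX_notin_center a : a != 0 -> elX a \notin Z.
Proof.
move=> a0; apply/negP => /sl2_centerP[b bb /sl2_mx_inj[]]; rewrite ?detX ?mul0r ?subr0 //.
by move=> _ /eqP; rewrite (negPf a0).
Qed.

(** A nontrivial centre would be everything by [psl2_normal], but the commutator of [elX 1] and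
    [elY 1] is not scalar. *)
Lemma psl2_center : 'Z([set: psl2]) = 1%g.
Proof.
apply/trivgP/subsetP => a aC; rewrite in_set1; apply/eqP.
have [x xa] := psl2_proj_surj a; rewrite -xa in aC *; apply/psl2_proj_eq1.
case: (boolP (x \in Z)) => // nx; exfalso.
have /setP/(_ (psl2_proj (elX 1))) := psl2_normal (center_normal [set: psl2]) aC nx.
rewrite in_setT => /centerP[_ /(_ (psl2_proj (elY 1)) (in_setT _))].
rewrite /commute -!psl2_projM => E.
have : psl2_proj (elX 1 * elY 1 * (elY 1 * elX 1)^-1)%g = 1%g.
  by rewrite psl2_projM E -psl2_projM mulgV; apply/psl2_proj_eq1; rewrite group1.
move/psl2_proj_eq1/sl2_centerP => [b bb].
rewrite !sl2_mxM ?detX ?detY // sl2_mxV; last by ring.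
rewrite sl2_mxM; [|by ring|by ring] => /sl2_mx_inj[]; try by [ring|rewrite bb; ring].
move=> _ _ H _; have : 1 = 0 :> F by rewrite -[RHS]H; ring.
by move/eqP; rewrite oner_eq0.
Qed.

Lemma psl2_simple : simple [set: psl2].
Proof.
apply/simpleP; split=> [|K nK].
  apply/eqP => /setP/(_ (psl2_proj (elX 1))); rewrite in_setT => /esym/set1P/psl2_proj_eq1.
  by apply/negP/elX_notin_center/oner_neq0.
have [|/subsetPn[a aK]] := boolP (K \subset [1 psl2]%g).
  by move/trivgP; left.
rewrite in_set1 => a1; right; have [x xa] := psl2_proj_surj a; rewrite -xa in aK a1.
by apply: psl2_normal aK _ => //; apply: contraNN a1 => /psl2_proj_eq1 ->.
Qed.

(** This involution plays the role of [sg] in the action on kernels. *)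
Definition psl2_J : psl2 := psl2_proj (sl2_mx 0 (- 1) 1 0).

Lemma detJ : 0 * 0 - (- 1) * 1 = 1 :> F. Proof. by ring. Qed.

Lemma psl2_J1 : psl2_J != 1%g.
Proof.
apply/eqP => /psl2_proj_eq1/sl2_centerP[b bb /sl2_mx_inj[]]; rewrite ?detJ ?mul0r ?subr0 //.
by move=> _ _ /eqP; rewrite oner_eq0.
Qed.

Lemma psl2_J2 : (psl2_J * psl2_J)%g = 1%g.
Proof.
rewrite -psl2_projM; apply/psl2_proj_eq1/sl2_centerP; exists (- 1); first by rewrite mulrNN mulr1.
by rewrite sl2_mxM ?detJ //; congr sl2_mx; ring.
Qed.

(** The p-th power of x is a scalar b with b^2 = 1, and b^p = b as p is odd. By Frobenius (x - b)^p
    = 0, so b is an eigenvalue of x; with determinant one this gives b tr(x) = 2. *)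
Lemma unipotent_trace p x : p \in [pchar F]%R -> odd p -> (psl2_proj x ^+ p)%g = 1%g ->
  \tr (val x) ^+ 2 = 4%:R.
Proof.
move=> pF op xp.
have expP k : psl2_proj (x ^+ k)%g = (psl2_proj x ^+ k)%g.
  by elim: k => [|k IH]; rewrite ?expgS ?psl2_projM ?IH //; apply/psl2_proj_eq1; rewrite group1.
move: xp; rewrite -expP => /psl2_proj_eq1/sl2_centerP[b bb].
have valX k : val (x ^+ k)%g = val x ^+ k.
  by elim: k => [|k IH] //; rewrite expgS exprS -IH.
move=> /(congr1 val); rewrite valX val_sl2_mx ?mul0r ?subr0 // -mx2_scalar => xE.
have pM : p \in [pchar 'M[F]_2]%R by rewrite pchar_lalg.
have bp : b ^+ p = b.
  by rewrite -(odd_double_half p) op add1n exprS -mul2n exprM expr2 bb expr1n mulr1.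
have cb : GRing.comm (val x) (b%:M) := comm_mx_scalar b (val x).
have sX k : b%:M ^+ k = (b ^+ k)%:M :> 'M[F]_2.
  by elim: k => [|k IH] //; rewrite !exprS IH scalar_mxM.
have /(congr1 determinant) := GRing.pFrobenius_autB_comm pM cb.
rewrite !GRing.pFrobenius_autE xE sX bp subrr det0.
have detX' k (M : 'M[F]_2) : \det (M ^+ k) = \det M ^+ k.
  by elim: k => [|k IH]; rewrite ?expr0 ?det1 // !exprS -IH -det_mulmx.
rewrite detX' => /eqP; rewrite expf_eq0 => /andP[_ /eqP].
have [[[[a' b'] c'] d'] [E ->]] := sl2P x.
rewrite val_sl2_mx // mx2_scalar tr_mx2 => D.
have : (a' - b) * (d' - b) - b' * c' = 0.
  by rewrite -det_mx2 -D; congr determinant; apply: eq_mx2; rewrite !mxE //= ?subr0.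
move=> D0; have D1 : b * (a' + d') = 2%:R.
  have : a' * d' - b' * c' + b * b - b * (a' + d') = 0 by rewrite -D0; ring.
  by rewrite E bb => /eqP; rewrite subr_eq0 => /eqP <-.
have : (b * (a' + d')) ^+ 2 = 4%:R by rewrite D1 -natrX.
by rewrite exprMn expr2 bb mul1r.
Qed.

End PSL2.

(** Over a prime field [elX 1] generates all [elX u]. Multiplying the given matrix by these on both
    sides makes it antidiagonal, and conjugation by the result turns [elX] into [elY]. *)
Lemma generate_sl2 (F : finFieldType) (K : {group sl2 F}) (a b c d : F) :
  (forall u : F, exists k, u = k%:R) ->
  a * d - b * c = 1 -> c != 0 -> elX 1 \in K -> sl2_mx a b c d \in K -> K = [set: sl2 F] :> {set sl2 F}.
Proof.
move=> Fnat E c0 XK gK.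
have KX (u : F) : elX u \in K.
  have [k ->] := Fnat u; elim: k => [|k IH]; first by have := group1 K; rewrite sl2_mx1.
  by rewrite -natr1 -elXD groupM.
have hK : sl2_mx 0 (- c^-1) c 0 \in K.
  suff <- : (elX (- (a / c)) * sl2_mx a b c d * elX (- (d / c)))%g = sl2_mx 0 (- c^-1) c 0.
    by rewrite !groupM.
  have bE : b = (a * d - 1) / c by rewrite -E; field.
  rewrite !sl2_mxM ?detX ?bE //; try by field.
  by congr sl2_mx; field.
have dh : 0 * 0 - - c^-1 * c = 1 by field.
have KY (u : F) : elY u \in K.
  suff <- : (elX (- u / c ^+ 2) ^ (sl2_mx 0 (- c^-1) c 0)^-1)%g = elY u.
    by apply: groupJ; [apply: KX | rewrite groupV].
  rewrite conjgE invgK sl2_mxV // !sl2_mxM ?detX //; try by field.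
  by congr sl2_mx; field.
apply/setP => x; rewrite in_setT; have [[[[q r] s] t] [E' ->]] := sl2P x.
exact: mem_sl2_mx.
Qed.

(** * Degrees of traces *)

Section Unipotent.
Variable R : comNzRingType.
Implicit Types c d : R.
Definition mX c : 'M[R]_2 := mx2 1 c 0 1.
Definition mY c : 'M[R]_2 := mx2 1 0 c 1.

Lemma mXD c d : mX c *m mX d = mX (c + d).
Proof. by rewrite mul_mx2; congr mx2; ring. Qed.
Lemma mYD c d : mY c *m mY d = mY (c + d).
Proof. by rewrite mul_mx2; congr mx2; ring. Qed.
Lemma mX0 : mX 0 = 1. Proof. by rewrite /mX -mx2_1. Qed.
Lemma mY0 : mY 0 = 1. Proof. by rewrite /mY -mx2_1. Qed.
End Unipotent.

Section TraceDegree.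
Variable F : fieldType.
Implicit Types (cs : seq (F * F)).

Definition prodXY cs : 'M[{poly F}]_2 := \prod_(q <- cs) (mX q.1%:P *m mY (q.2 *: 'X)).

(** Each factor raises the degree of the upper left entry by exactly one. The lower right entry has
    smaller degree except for the empty product, where both are 1; hence the correction term. *)
Lemma prodXY_size cs : all (fun q => (q.1 != 0) && (q.2 != 0)) cs ->
  [/\ size (prodXY cs 0 0) = (size cs).+1, (size (prodXY cs 0 1)%R <= size cs)%N,
      (size (prodXY cs 1 0)%R <= (size cs).+1)%N &
      (size (prodXY cs 1 1)%R <= (size cs).+1 - (cs != [::]))%N].
Proof.
elim: cs => [|[c e] cs IH] /=.
  by rewrite /prodXY big_nil; split; rewrite !mxE //= ?mulr1n ?mulr0n ?size_poly1 ?size_poly0.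
move=> /andP[/andP[c0 e0] /IH]; rewrite /prodXY big_cons -/(prodXY cs).
set M := prodXY cs => -[sA sB sC sD].
have {}sD : (size (M 1 1)%R <= (size cs).+1)%N by apply: leq_trans sD (leq_subr _ _).
have E : mX c%:P *m mY (e *: 'X) = mx2 (1 + (c * e) *: 'X) c%:P (e *: 'X) 1.
  by rewrite mul_mx2; congr mx2; rewrite -?mul_polyC ?polyCM; ring.
rewrite [M]mx2_eta /= E -mulmxE mul_mx2 !mx2E subn1 /=.
have sX (b : F) (q : {poly F}) : (size ((b *: 'X) * q)%R <= (size q).+1)%N.
  rewrite -scalerAl; apply: leq_trans (size_scale_leq _ _) _.
  by have [->|q0] := eqVneq q 0; rewrite ?mulr0 ?size_poly0 // mulrC size_mulX.
have sC' (b : F) (q : {poly F}) : (size (b%:P * q)%R <= size q)%N.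
  by rewrite mul_polyC size_scale_leq.
have sS k (q r : {poly F}) : (size q <= k)%N -> (size r <= k)%N -> (size (q + r)%R <= k)%N.
  by move=> hq hr; apply: leq_trans (size_polyD _ _) _; rewrite geq_max hq.
have A0 : M 0 0 != 0 by rewrite -size_poly_eq0 sA.
split.
- have SA : size (((c * e) *: 'X) * M 0 0) = (size cs).+2.
    by rewrite -scalerAl size_scale ?mulf_neq0 // mulrC size_mulX // sA.
  rewrite mulrDl mul1r -addrA addrCA size_polyDl SA // ltnS.
  by apply: (sS); rewrite ?sA // (leq_trans (sC' _ _)).
- rewrite mulrDl mul1r; apply: (sS); last exact: leq_trans (sC' _ _) _.
  by apply: (sS); [exact: leqW|apply: leq_trans (sX _ _) _].
- rewrite mul1r; apply: (sS); last exact: leq_trans sC _.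
  by rewrite (leq_trans (sX _ _)) // sA.
- rewrite mul1r; apply: (sS) => //; by rewrite (leq_trans (sX _ _)).
Qed.

Lemma prodXY_trace cs : all (fun q => (q.1 != 0) && (q.2 != 0)) cs -> cs != [::] ->
  size (\tr (prodXY cs)) = (size cs).+1.
Proof.
move=> /prodXY_size[sA _ _ sD] c0; rewrite [prodXY cs]mx2_eta tr_mx2 size_polyDl //.
by rewrite sA ltnS; move: sD; rewrite c0 subn1.
Qed.

End TraceDegree.

Section LetterMatrices.
Variables (F : fieldType) (n : nat) (sp : pred 'I_n) (a : letter n -> F).
Implicit Types (y z : letter n) (s : seq (letter n)).
Hypothesis sp_uniq : forall i i', sp i -> sp i' -> i = i'.

Definition sgl y : F := if y.2 then -1 else 1.

(** Inverse letters get inverse matrices, and between adjacent nonspecial letters y, z the exponent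
    of X is a(z) - a(y^-1), nonzero for separated labels unless they cancel. The map [phi] allows
    both a polynomial variable and a value for t. *)
Definition lmx (R : comNzRingType) (phi : F -> R) (t : R) y : 'M[R]_2 :=
  if sp y.1 then mX (phi (sgl y)) else
  mX (phi (a y)) *m mY (phi (sgl y) * t) *m mX (phi (- a (linv y))).

Lemma sgl_linv y : sgl (linv y) = - sgl y.
Proof. by rewrite /sgl /=; case: y.2; rewrite ?opprK. Qed.

Lemma sgl_neq0 y : sgl y != 0.
Proof. by rewrite /sgl; case: y.2; rewrite ?oppr_eq0 oner_eq0. Qed.

Lemma lmxV (R : comNzRingType) (phi : {rmorphism F -> R}) t y : lmx phi t y * lmx phi t (linv y) = 1.
Proof.
rewrite /lmx /= -/(linv y) linvK sgl_linv; case: ifP => _.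
  by rewrite -mulmxE mXD -rmorphD subrr rmorph0 mX0.
rewrite -mulmxE -!mulmxA (mulmxA (mX (phi (- a (linv y))))) mXD -rmorphD addNr rmorph0 mX0 mul1mx.
rewrite (mulmxA (mY _)) mYD -mulrDl -rmorphD subrr rmorph0 mul0r mY0 mul1mx mXD -rmorphD subrr.
by rewrite rmorph0 mX0.
Qed.

Definition wmx (R : comNzRingType) (phi : F -> R) (t : R) s : 'M[R]_2 := \prod_(y <- s) lmx phi t y.

Lemma wmx_cat (R : comNzRingType) (phi : F -> R) t s1 s2 :
  wmx phi t (s1 ++ s2) = wmx phi t s1 * wmx phi t s2.
Proof. exact: big_cat. Qed.

Lemma wmx_red (R : comNzRingType) (phi : {rmorphism F -> R}) t s : wmx phi t (red s) = wmx phi t s.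
Proof. by apply: big_red => y; exact: lmxV. Qed.

Local Notation pmx := (wmx (@polyC F) 'X).

(* State: the last non-special letter z and the special translation k
   accumulated since. *)
Fixpoint sylls z (k : F) s : seq (F * F) :=
  if s is y :: s' then
    if sp y.1 then sylls z (k + sgl y) s'
    else (k + a y - a (linv z), sgl y) :: sylls y 0 s'
  else [::].

(** The left factor is the power of X still pending: the end of the matrix of z and the special
    letters read since. A final nonspecial letter leaves only its own right factor. *)
Lemma pmx_sylls z k s y : ~~ sp y.1 ->
  mX (k - a (linv z))%:P *m pmx (rcons s y) =
  prodXY (sylls z k (rcons s y)) *m mX (- a (linv y))%:P.
Proof.
have step z' k' x s' : ~~ sp x.1 -> mX (k' - a (linv z'))%:P *m pmx (x :: s') =
    mX (k' + a x - a (linv z'))%:P *m mY (sgl x *: 'X) *m (mX (0 - a (linv x))%:P *m pmx s').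
  move=> /negPf nx; rewrite /wmx big_cons -/(wmx _ _ _) /lmx /= nx -!mulmxE !mulmxA mXD -polyCD.
  by rewrite sub0r mul_polyC addrAC.
move=> ny; elim: s z k => [|x s IH] z k /=.
  rewrite (negPf ny) step // /prodXY big_cons /wmx !big_nil /=.
  by rewrite -mulmxE sub0r !mulmx1.
case: ifPn => spx; last by rewrite step // /prodXY big_cons -/(prodXY _) /= IH -!mulmxE !mulmxA.
rewrite -IH /wmx big_cons -/(wmx _ _ _) /lmx spx /= -mulmxE mulmxA mXD -polyCD.
by congr (mX _%:P *m _); ring.
Qed.

Lemma size_sylls z k s : size (sylls z k s) = count (fun y => ~~ sp y.1) s.
Proof. by elim: s z k => [|y s IH] z k //=; case: (sp y.1); rewrite /= IH. Qed.

Variable B : nat.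
Hypothesis sepa : forall (b : bool) m y z, (m <= B)%N -> (m = 0%N -> y <> z) ->
  (if b then - m%:R else m%:R) + a y - a z != 0.

(** Invariant: x is the last letter read and m the number of special letters since z. All of these
    have the sign b, because a reduced word cannot change sign within a run of the unique special
    index. The bound by B keeps [sepa] applicable. *)
Lemma all_sylls z k s : ~~ sp z.1 ->
  (exists m b, [/\ k = if b then - m%:R else m%:R, (m + size s <= B)%N &
    exists2 x, path (@nocancel n) x s & if m is 0 then x = z else sp x.1 /\ x.2 = b]) ->
  all (fun q => (q.1 != 0) && (q.2 != 0)) (sylls z k s).
Proof.
elim: s z k => [|y s IH] z k nz //= [m [b [-> mB [x /andP[nxy py] xm]]]].
case: ifPn => spy /=; last first.
  rewrite sgl_neq0 andbT IH //; last first.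
    exists 0%N, false; split=> //; last by exists y.
    by apply: leq_trans mB; rewrite addnS leqW // leq_addl.
  rewrite andbT; apply: sepa; first by apply: leq_trans mB; apply: leq_addr.
  by move=> m0; rewrite m0 in xm; apply/eqP; rewrite -xm.
apply: IH => //; case: m xm mB => [|m] /= xm mB.
  exists 1%N, y.2; split=> //; last by exists y.
  by rewrite /sgl; case: b; case: y.2; rewrite ?oppr0 add0r.
exists m.+2, b; split; [|by rewrite addSnnS|exists y => //].
  have [spx xb] := xm; have yx : y.1 = x.1 by apply: sp_uniq.
  have yb : y.2 = b.
    move: nxy; rewrite /nocancel /linv; case: (y) yx => i c /= ->; rewrite xpair_eqE eqxx /= xb.
    by case: b {xb mB xm}; case: c.
  by rewrite /sgl yb; case: b {xb mB xm yb}; rewrite -[m.+2%:R]natr1 ?opprD.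
split=> //; have [spx xb] := xm; have yx : y.1 = x.1 by apply: sp_uniq.
move: nxy; rewrite /nocancel /linv; case: (y) yx => i c /= ->; rewrite xpair_eqE eqxx /= xb.
by case: b {xb mB xm}; case: c.
Qed.

(** After a rotation the word ends in a nonspecial letter y, whose right factor is moved to the
    front under the trace. Thus y also acts as the letter before the first one, and cyclic
    reducedness covers this junction. *)
Theorem trace_size s : path.cycle (@nocancel n) s -> has (fun y => ~~ sp y.1) s -> (size s <= B)%N ->
  size (\tr (pmx s)) = (count (fun y => ~~ sp y.1) s).+1.
Proof.
move=> cs hs sB; have [y ys ny] := hasP hs.
have [i r rE] := rot_to ys.
have -> : \tr (pmx s) = \tr (pmx (rcons r y)).
  rewrite -cats1 wmx_cat -mulmxE mxtrace_mulC mulmxE -wmx_cat cat1s -rE /rot.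
  by rewrite wmx_cat -mulmxE mxtrace_mulC mulmxE -wmx_cat cat_take_drop.
have pE : perm_eq s (rcons r y).
  by rewrite perm_sym perm_rcons -rE perm_rot.
rewrite (seq.permP pE) -(size_sylls y 0).
have := pmx_sylls y 0 r ny; rewrite sub0r => E.
have -> : \tr (pmx (rcons r y)) = \tr (prodXY (sylls y 0 (rcons r y))).
  have -> : pmx (rcons r y) = mX (a (linv y))%:P *m (mX (- a (linv y))%:P *m pmx (rcons r y)).
    by rewrite mulmxA mXD -polyCD subrr mX0 mul1mx.
  by rewrite E mxtrace_mulC -mulmxA mXD -polyCD addNr mX0 mulmx1.
apply: prodXY_trace; last first.
  by rewrite -size_eq0 size_sylls -lt0n -has_count has_rcons ny.
apply: all_sylls => //; exists 0%N, false; split=> //.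
  by rewrite -(perm_size pE) add0n.
by exists y => //; rewrite -[path _ _ _]/(path.cycle _ (y :: r)) -rE rot_cycle.
Qed.

End LetterMatrices.

(** The labels are distinct multiples of B + 1, and p is too large for wrapping around: two labels
    differing by m at most B force m = 0. The lower bound K on p is left to later choices. *)
Lemma separated_labels n B K : exists (F : finFieldType) p (a : letter n -> F),
  [/\ prime p /\ (K < p)%N, p \in [pchar F]%R, #|F| = p, forall w : F, exists k, w = k%:R &
  forall (b : bool) m y z, (m <= B)%N -> (m = 0%N -> y <> z) ->
  (if b then - m%:R else m%:R) + a y - a z != 0].
Proof.
pose idx (y : letter n) := (B.+1 * enum_rank y)%N.
pose L := (B.+1 * #|{: letter n}|)%N.
have [p pL pp] := prime_above (B + L + K).
exists 'F_p, p, (fun y => (idx y)%:R); split; last 1 first.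
- move=> b m y z mB myz.
  have idxL w : (idx w <= L)%N by rewrite leq_mul2l ltnW ?orbT // ltn_ord.
  have natF k l : (k <= B + L)%N -> (l <= B + L)%N -> k%:R = l%:R :> 'F_p -> k = l.
    move=> kL lL /(congr1 val); rewrite /= !val_Fp_nat // !modn_small //.
      by rewrite (leq_ltn_trans _ pL) // (leq_trans lL) ?leq_addr.
    by rewrite (leq_ltn_trans _ pL) // (leq_trans kL) ?leq_addr.
  have key y1 y2 : (m = 0%N -> y1 <> y2) -> (m + idx y1)%:R <> (idx y2)%:R :> 'F_p.
    move=> ny /natF E; have {}E : (m + idx y1 = idx y2)%N.
      by apply: E; [rewrite leq_add | rewrite (leq_trans (idxL _)) ?leq_addl].
    have m0 : m = 0%N.
      have := congr1 (modn^~ B.+1) E; rewrite /= addnC /idx ![(B.+1 * _)%N]mulnC modnMDl modnMl.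
      by rewrite modn_small.
    apply: ny => //; move: E; rewrite m0 add0n => /eqP; rewrite eqn_mul2l /=.
    by move=> /eqP /val_inj /enum_rank_inj.
  rewrite subr_eq0; apply/eqP; case: b => E; last by apply: (key y z) => //; rewrite natrD.
  apply: (key z y) => [m0 zy|]; first by apply: myz.
  by rewrite natrD -E addrA subrr add0r.
- by rewrite pp (leq_ltn_trans _ pL) // leq_addl.
- exact: pchar_Fp.
- exact: card_Fp.
by move=> w; exists (w : nat); rewrite natr_Zp.
Qed.

Lemma FG_cyclic_form n (u : FG n) : exists2 s, path.cycle (@nocancel n) s & exists g, u = (word s ^ g)%g.
Proof.
rewrite -(word_val u); have := valP u; move: (val u) => s /=.
have [k] := ubnP (size s); elim: k s => // k IH [|x p] /= sk rs.
  by exists [::] => //; exists 1%g; rewrite conjg1.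
have [cs|] := boolP (nocancel (last x p) x).
  exists (x :: p); last by exists 1%g; rewrite conjg1.
  by rewrite /= rcons_path cs andbT.
case/lastP: p sk rs => [|p z] sk rs.
  by rewrite /nocancel /= negbK => /eqP/(congr1 snd) /=; case: x.2.
rewrite last_rcons /nocancel negbK => /eqP xz.
move: rs; rewrite /reduced /= rcons_path => /andP[pp _].
have [|s cs [g gE]] := IH p _ (path_sorted pp).
  by move: sk; rewrite size_rcons ltnS => /ltnW.
exists s => //; exists (g * word [:: z])%g; rewrite conjgM -gE conjgE -(word_cat p) -word_winv -word_cat.
by rewrite xz -cats1.
Qed.

(** * Specialisation of the variable and detection of powers of a generator *)

Section Specialisation.
Variables (F : finFieldType) (n : nat) (i0 : 'I_n) (a : letter n -> F) (t : F).
Local Notation sp := (pred1 i0).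
Definition rep_sl2 (i : 'I_n) : sl2 F :=
  if sp i then elX 1 else (elX (a (i, false)) * elY t * elX (- a (i, true))%R)%g.

Lemma val_elX (b : F) : val (elX b) = mX b. Proof. by rewrite val_sl2_mx ?detX. Qed.
Lemma val_elY (b : F) : val (elY b) = mY b. Proof. by rewrite val_sl2_mx ?detY. Qed.

Lemma val_rep_sl2 s : val (ev rep_sl2 s) = wmx sp a idfun t s.
Proof.
have E0 i : val (rep_sl2 i) = lmx sp a idfun t (i, false).
  rewrite /rep_sl2 /lmx /= /sgl /= mul1r; case: ifP => _; first exact: val_elX.
  by rewrite !val_sl2M !val_elX val_elY.
have E y : val (lval rep_sl2 y) = lmx sp a idfun t y.
  case: y => i [] /=; rewrite /lval /= ?E0 //.
  have := lmxV sp a (R := F) idfun t (i, true).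
  rewrite /linv /= -E0 => /(congr1 (fun M => M *m val (rep_sl2 i)^-1%g)).
  by rewrite mul1mx -mulmxE -mulmxA -val_sl2M mulgV mulmx1 => ->.
elim: s => [|y s IH]; first by rewrite ev_nil /wmx big_nil.
by rewrite ev_cons val_sl2M IH E /wmx big_cons.
Qed.

Lemma horner_wmx s : (\tr (wmx sp a (@polyC _) 'X s)).[t] = \tr (wmx sp a idfun t s).
Proof.
have mapmx2 (q r v w : {poly F}) : map_mx (horner_eval t) (mx2 q r v w) = mx2 q.[t] r.[t] v.[t] w.[t].
  by apply: eq_mx2; rewrite !mxE.
rewrite -[LHS]/(horner_eval t _) -trace_map_mx; congr (\tr _).
elim: s => [|y s IH]; first by rewrite /wmx !big_nil map_mx1.
rewrite /wmx !big_cons -!/(wmx _ _ _ _ _) -!mulmxE map_mxM IH; congr (_ *m _).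
rewrite /lmx; case: ifP => _; first by rewrite mapmx2 !hornerE.
by rewrite !map_mxM !mapmx2 !hornerE.
Qed.

End Specialisation.

(** If the cyclically reduced form of u has a letter other than x_i0 and its inverse, some t makes
    the squared trace of its image differ from 4, against [unipotent_trace]. The condition c != 0 is
    the one that [generate_sl2] asks for. *)
Lemma unipotent_detect n (i0 : 'I_n) (u : FG n) :
  (forall (F : finFieldType) p (x : 'I_n -> sl2 F), p \in [pchar F]%R -> odd p -> 30%:R != 0 :> F ->
     (forall w : F, exists k, w = k%:R) -> x i0 = elX 1 ->
     (forall i, i != i0 -> exists q : F * F * F * F, let: (a, b, c, d) := q in
        [/\ a * d - b * c = 1, c != 0 & x i = sl2_mx a b c d]) ->
     (psl2_proj (ev x (val u)) ^+ p)%g = 1%g) ->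
  exists g m (b : bool), u = ((if b then (gen i0)^-1 else gen i0) ^+ m ^ g)%g.
Proof.
move=> H; have [s cs [g uE]] := FG_cyclic_form u.
have [hs|] := boolP (has (fun y => ~~ pred1 i0 y.1) s); last first.
  rewrite -all_predC => /allP all0; exists g.
  have {}all0 y : y \in s -> y.1 = i0 by move/all0; rewrite /= negbK => /eqP.
  suff [m [b sE]] : exists m b, s = nseq m (i0, b).
    exists m, b; rewrite uE; congr (_ ^ _)%g; rewrite sE -ev_word.
    elim: m {sE} => [|m IH]; first by rewrite ev_nil.
    by rewrite [nseq _ _]/= ev_cons IH expgS /lval; case: b {IH}.
  case: s cs all0 {uE} => [|y s] cs all0; first by exists 0%N, false.
  exists (size s).+1, y.2; have -> : (i0, y.2) = y.
    by rewrite -(all0 y (mem_head _ _)) -surjective_pairing.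
  congr (_ :: _).
  move: cs; rewrite /= rcons_path => /andP[ps _].
  elim: s y ps all0 => [|z s IH] y //= /andP[nyz ps] all0.
  have zy : z = y.
    move: nyz (all0 z) (all0 y); rewrite !inE !eqxx !orbT => nyz /(_ isT) z0 /(_ isT) y0.
    move: nyz; rewrite /nocancel /linv; case: (z) (y) z0 y0 => [? c] [? d] /= -> ->.
    by rewrite xpair_eqE eqxx /=; case: c; case: d.
  rewrite zy in ps all0 *; rewrite -IH // => w ws; apply: all0.
  by rewrite inE ws orbT.
exfalso.
(* The bound makes p odd, prime to 30, and larger than 2c + 1, the degree of the polynomial R whose
   roots are to be avoided. *)
have [F [p [a [[pp pK] pF cF Fnat sepa]]]] := separated_labels n (size s) (31 + 2 * size s).
set P := \tr (wmx (pred1 i0) a (@polyC _) 'X s).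
have sP : size P = (count (fun y => ~~ pred1 i0 y.1) s).+1.
  by apply: (trace_size _ sepa) => // i i' /eqP -> /eqP.
set c := count _ _ in sP.
have c0 : (0 < c)%N by rewrite -has_count.
have cs' : (c <= size s)%N by apply: count_size.
have sP2 : size (P ^+ 2 - 4%:R%:P) = (2 * c).+1.
  have E : size (P ^+ 2) = (2 * c).+1.
    have := size_exp P 2; rewrite sP /= mulnC => <-; rewrite prednK // size_poly_gt0 expf_neq0 //.
    by rewrite -size_poly_eq0 sP.
  rewrite size_polyDl ?E // size_polyN (leq_ltn_trans (size_polyC_leq1 _)) //.
  by rewrite ltnS muln_gt0.
(* The factor 'X forces t to be nonzero; t is the lower left entry of the images of the other
   generators. *)
set R := 'X * (P ^+ 2 - 4%:R%:P).
have P20 : P ^+ 2 - 4%:R%:P != 0 by rewrite -size_poly_eq0 sP2.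
have R0 : R != 0 by rewrite mulf_neq0 ?polyX_eq0.
have [t Rt] : exists t, ~~ root R t.
  apply/existsP; rewrite -negb_forall; apply/negP => /forallP all_root.
  have := max_poly_roots R0 (rs := enum F); rewrite enum_uniq -cardE cF => /(_ _ isT).
  have -> : all (root R) (enum F) by apply/allP => x _.
  move=> /(_ isT); rewrite /R mulrC size_mulX // sP2 ltnNge => /negP; apply.
  rewrite (leq_trans _ (ltnW pK)) //. 
  by rewrite -addn2 addnC; apply: leq_add => //; rewrite leq_mul2l cs' orbT.
move: Rt; rewrite /root hornerM hornerX mulf_eq0 negb_or => /andP[t0].
rewrite !hornerE /P horner_wmx => /eqP; apply.
have F30 : 30%:R != 0 :> F.
  rewrite -(dvdn_pcharf pF); apply/negP => /dvdn_leq -/(_ isT).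
  by rewrite leqNgt (leq_trans _ pK) // ltnS leq_addr.
have op : odd p by case/even_prime: (pp) => // p2; rewrite p2 in pK.
have {}H := H F p (rep_sl2 i0 a t) pF op F30 Fnat.
have /H {}H : rep_sl2 i0 a t i0 = elX 1 by rewrite /rep_sl2 /= eqxx.
have : (psl2_proj (ev (rep_sl2 i0 a t) (val u)) ^+ p)%g = 1%g.
  apply: H => i ni; rewrite /rep_sl2 /= (negPf ni).
  exists (1 + a (i, false) * t, (1 + a (i, false) * t) * - a (i, true) + a (i, false), t,
    t * - a (i, true) + 1); split=> //; first by ring.
  rewrite !sl2_mxM ?detX ?detY //; last by ring.
  by congr sl2_mx; ring.
move/(unipotent_trace pF op) => T; rewrite -T uE conjgE !ev_mul.
have morV := morph_inv (ev_mul (rep_sl2 i0 a t)).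
rewrite morV !val_sl2M mulmxA mxtrace_mulC mulmxA -val_sl2M mulgV mul1mx ev_wordE val_rep_sl2.
by rewrite expr2 subrr.
Qed.

(** * Automorphisms acting on primitive elements by conjugation and inversion *)

Local Close Scope ring_scope.

Definition sgn_pow (G : groupType) (b : bool) (x : G) := if b then x^-1 else x.

Section Sign.
Variables (G H : groupType).
Lemma morph_sgn (f : G -> H) b x : {morph f : u v / u * v} -> f (sgn_pow b x) = sgn_pow b (f x).
Proof. by move=> fM; case: b; rewrite /= ?(morph_inv fM). Qed.
Lemma morph_conj (f : G -> H) (x y : G) : {morph f : u v / u * v} -> f (x ^ y) = f x ^ f y.
Proof. by move=> fM; rewrite !conjgE !fM (morph_inv fM). Qed.
End Sign.

Section ConjugatePrimitives.
Variable n : nat.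
Implicit Types (phi theta psi : FG n -> FG n) (i j : 'I_n).

(** Applying the inverse of [psi] makes x_i conjugate to an m-th power. Sending x_i to a generator
    of Z/m, or of Z/2 when m = 0, excludes every m other than 1. *)
Lemma aut_gen_exponent psi i m b (g : FG n) : is_aut psi ->
  psi (gen i) = sgn_pow b (gen i) ^+ m ^ g -> m = 1%N.
Proof.
move=> apsi E; have [chi achi [chiK _]] := inv_aut apsi.
have chiM := aut_morph achi.
have key q : (forall y : 'I_q.+2, y ^+ m = 1) -> False.
  move=> ym; pose h (k : 'I_n) : 'I_q.+2 := if k == i then Zp1 else 1.
  have fM : {morph (fun u => ev h (val (chi u))) : u v / u * v}.
    by move=> u v; rewrite chiM ev_mul.
  have := congr1 (fun u => ev h (val (chi u))) E.
  rewrite /= chiK ev_gen (morph_conj _ _ fM) (morph_X _ fM) ym conj1g /h eqxx.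
  by move/(congr1 val).
case: m E key => [|[|m]] _ key //; first by case: (key 0%N) => y; rewrite expg0.
by case: (key m) => y; have := expg_cardG (in_setT y); rewrite cardsT card_ord.
Qed.

(** As n is at least 3, a generator j1 can be left out while x_i and x_j2 still map to generators of
    SL(2,p). The resulting f kills [theta (w ^+ p)], hence also the image of [out_rep C (w ^+ p)]
    under [theta], and [unipotent_detect] applies. *)
Lemma frattini_f_primitive (C : Out n) theta w i : (2 < n)%N ->
  frattini_f (@out_mul n) (out_one n) C -> is_aut theta -> theta w = gen i ->
  exists g b, out_rep C w = sgn_pow b w ^ g.
Proof.
move=> n3 fC ath tw; have aphi := out_rep_aut C; set phi := out_rep C in aphi *.
have [j1 [j2 [j1i j2i j12]]] : exists j1 j2, [/\ j1 != i, j2 != i & j1 != j2].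
  have : (1 < #|[set~ i]|)%N by rewrite cardsC1 card_ord; case: n n3 => [|[|[|]]].
  by case/card_gt1P => j1 [j2 []]; rewrite !inE => *; exists j1, j2.
have [g [m [b E]]] : exists g m b, theta (phi w) = sgn_pow b (gen i) ^+ m ^ g.
  apply: unipotent_detect => F p x pF op F30 Fnat xi xj.
  pose f : {ffun 'I_n -> psl2 F} := [ffun k => psl2_proj (x k)].
  have evf s : ev f s = psl2_proj (ev x s).
    by rewrite (morph_ev _ _ (@psl2_projM F)); apply: eq_in_ev => y _; rewrite ffunE.
  pose K := [set y | `[< exists2 s, avoids j1 s & ev x s = y >]].
  have gK : group_set K.
    apply/group_setP; split=> [|_ _ /[!inE] /asboolP[s avs <-] /asboolP[t avt <-]].
      by rewrite inE; apply/asboolP; exists [::]; rewrite ?ev_nil.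
    by apply/asboolP; exists (s ++ t); rewrite ?ev_cat // avoids_cat avs.
  have Kx k : k != j1 -> x k \in K.
    move=> kj; rewrite inE; apply/asboolP; exists [:: (k, false)]; first by rewrite /avoids /= kj.
    by rewrite ev_cons ev_nil mulg1.
  have KT : K = [set: sl2 F].
    have [[[[a' b'] c'] d'] [dE c0 xE]] := xj j2 j2i.
    apply: (@generate_sl2 _ (Group gK) a' b' c' d') => //.
      by rewrite -xi; apply: Kx; rewrite eq_sym.
    by rewrite -xE; apply: Kx; rewrite eq_sym.
  have genf a : exists2 s, avoids j1 s & ev f s = a.
    have [y <-] := psl2_proj_surj a; have : y \in K by rewrite KT inE.
    by rewrite inE => /asboolP[s avs <-]; exists s; rewrite ?evf.
  have wp : ev f (val (theta (w ^+ p))) = 1.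
    rewrite (morph_X _ (aut_morph ath)) tw (morph_X _ (ev_mul f)) ev_gen ffunE xi.
    have -> k : psl2_proj (elX (1 : F)%R) ^+ k = psl2_proj (elX (k%:R : F)%R).
      elim: k => [|k IH]; last by rewrite expgS IH -psl2_projM elXD -GRing.mulrS.
      by apply/esym/psl2_proj_eq1; have := group1 'Z([set: sl2 F])%G; rewrite sl2_mx1.
    by rewrite (GRing.pcharf0 pF); apply/psl2_proj_eq1; have := group1 'Z([set: sl2 F])%G; rewrite sl2_mx1.
  have := frattini_f_kernel (psl2_simple F30) (psl2_center F30) (psl2_J1 F) (psl2_J2 F) genf fC ath wp.
  by rewrite -/phi (morph_X _ (aut_morph aphi)) (morph_X _ (aut_morph ath)) (morph_X _ (ev_mul f)) evf.
have [chi achi [chiK thK]] := inv_aut ath.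
have m1 : m = 1%N.
  apply: (@aut_gen_exponent (theta \o phi \o chi) i _ b g).
    exact: comp_aut (comp_aut ath aphi) achi.
  by rewrite /= -E -tw chiK.
exists (chi g), b; rewrite -[LHS]chiK E m1 expg1 (morph_conj _ _ (aut_morph achi)).
by rewrite (morph_sgn _ _ (aut_morph achi)) -tw chiK.
Qed.

Lemma frattini_f_primitive_word (C : Out n) i s : (2 < n)%N -> avoids i s ->
  frattini_f (@out_mul n) (out_one n) C ->
  exists g b, out_rep C (gen i * word s) = sgn_pow b (gen i * word s) ^ g.
Proof.
move=> n3 avs fC; have avs' : avoids i (winv s) by rewrite avoids_winv.
apply: (frattini_f_primitive (theta := transv i [::] (winv s)) (i := i) n3 fC).
  exact: transv_aut.
rewrite transv_morph transv_genE /transv_gen eqxx transv_word // word_winv mulgVK.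
by rewrite -[RHS]mul1g.
Qed.

End ConjugatePrimitives.

(** * Lengths of cyclically reduced words and images of pairs of generators *)

Section Combinatorics.
Variable n : nat.
Implicit Types (phi : FG n -> FG n) (i j : 'I_n) (s t : seq (letter n)).

(** With no special letter the degree of the trace is the length of the word, and the trace is
    invariant under conjugation. *)
Lemma conj_cyclic_size s t (g : FG n) : path.cycle (@nocancel n) s -> path.cycle (@nocancel n) t ->
  s != [::] -> t != [::] -> word s = word t ^ g -> size s = size t.
Proof.
move=> cs ct s0 t0 E.
have [F [p [a [_ _ _ _ sepa]]]] := separated_labels n (size s + size t) 0.
pose M := wmx pred0 a (@polyC F) 'X%R.
have trE : (\tr (M s) = \tr (M t))%R.
  have MW r : (M r * M (winv r))%R = 1%R.
    by rewrite -{1}(winvK r) -wmx_cat -wmx_red red_winv /wmx big_nil.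
  have : word s = word (winv (val g) ++ t ++ val g).
    by rewrite E conjgE !word_cat word_winv word_val.
  move/(congr1 val) => /= /(congr1 M); rewrite /M !wmx_red !wmx_cat => ->.
  by rewrite -!mulmxE mxtrace_mulC -mulmxA mulmxE MW -mulmxE mulmx1.
have cnt r : count (fun y : letter n => ~~ pred0 y.1) r = size r by apply: count_predT.
have hasr r : r != [::] -> has (fun y : letter n => ~~ pred0 y.1) r by case: r.
have sz r : path.cycle (@nocancel n) r -> r != [::] -> (size r <= size s + size t)%N ->
    size (\tr (M r))%R = (size r).+1.
  by move=> cr r0 rB; rewrite (trace_size _ sepa) ?cnt ?hasr.
by have := sz _ cs s0 (leq_addr _ _); rewrite trE sz ?leq_addl // => -[].
Qed.

Lemma nocancel_index (x y : letter n) : x.1 != y.1 -> nocancel x y.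
Proof. by apply: contraNneq => ->. Qed.

Definition only i s := all (fun x : letter n => x.1 == i) s.

Lemma only_commute i s : only i s -> commute (word s) (gen i).
Proof.
elim: s => [|[k b] s IH] //=.
move=> /andP[/eqP /= ki /IH c]; rewrite -cat1s word_cat; apply: commute_sym; apply: commuteM; last exact: commute_sym.
by rewrite ki; case: b => //; apply: (commuteV (commute_refl (gen i))).
Qed.

(** The word r represents the double coset of s with respect to the subgroups generated by x_i and
    x_j. *)
Lemma strip_word i j s : reduced s -> exists t1 r t2,
  [/\ only i t1, only j t2, reduced r /\ word s = word t1 * word r * word t2,
      forall x r', r = x :: r' -> x.1 != i & forall x r', r = rcons r' x -> x.1 != j].
Proof.
have [k] := ubnP (size s); elim: k s => // k IH s sk rs.
case: s sk rs => [|x s] sk rs.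
  by exists [::], [::], [::]; split=> // x [].
have [xi|xi] := eqVneq x.1 i.
  have [|t1 [r [t2 [o1 o2 [rr E] h1 h2]]]] := IH s sk; first exact: path_sorted rs.
  exists (x :: t1), r, t2; split; rewrite //= ?xi ?eqxx //; split=> //.
  by rewrite -cat1s -[x :: t1]cat1s !word_cat E !mulgA.
case/lastP E: (x :: s) => [|s' y] //; rewrite E in rs sk.
have [yj|yj] := eqVneq y.1 j; last first.
  exists [::], (rcons s' y), [::]; split=> //; first by split; rewrite // -!word_cat cats0.
    by move=> z r'; rewrite -E => -[<-].
  by move=> z r' /rcons_inj[_ <-].
have [||t1 [r [t2 [o1 o2 [rr Es] h1 h2]]]] := IH s'.
- by move: sk; rewrite size_rcons.
- move: rs; rewrite /reduced; case: (s') => //= z r'; by rewrite rcons_path => /andP[].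
exists t1, r, (rcons t2 y); split=> //; first by rewrite /only all_rcons yj eqxx.
by split=> //; rewrite -!cats1 !word_cat Es !mulgA.
Qed.

Lemma conj_word_cycle i j (e d : bool) s : i != j -> s != [::] -> reduced s ->
  (forall x r, s = x :: r -> x.1 != i) -> (forall x r, s = rcons r x -> x.1 != j) ->
  path.cycle (@nocancel n) ((i, e) :: s ++ (j, d) :: winv s).
Proof.
move=> ij s0 rs h1 h2; rewrite /= rcons_path cat_path last_cat /=.
have [y [r1 sE]] : exists y r, s = y :: r by case: s s0 {rs h1 h2} => // y r _; exists y, r.
have [z [r2 sE']] : exists z r, s = rcons r z.
  by case/lastP: s s0 {rs h1 h2 sE} => // r z _; exists z, r.
have yi := h1 _ _ sE; have zj := h2 _ _ sE'.
have wE : winv s = linv z :: winv r2 by rewrite sE' /winv map_rcons rev_rcons.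
have wE' : winv s = rcons (winv r1) (linv y) by rewrite sE /winv /= rev_cons.
have rw := reduced_winv rs.
apply/andP; split; last by rewrite wE' last_rcons; apply: nocancel_index.
apply/and3P; split.
- rewrite sE /=; move: rs; rewrite sE /reduced /= => ->; rewrite andbT.
  by apply: nocancel_index; rewrite eq_sym.
- by rewrite sE' last_rcons; apply: nocancel_index.
rewrite wE /=; move: rw; rewrite wE /reduced /= => ->; rewrite andbT.
by apply: nocancel_index; rewrite eq_sym.
Qed.

(* [gen i * word s] is primitive when s avoids i. *)
Definition primitive_conj phi := forall i s, avoids i s ->
  exists g b, phi (gen i * word s) = sgn_pow b (gen i * word s) ^ g.

Lemma primitive_conj_gen phi i : primitive_conj phi -> exists g b, phi (gen i) = sgn_pow b (gen i) ^ g.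
Proof. by move=> /(_ i [::] isT); rewrite mulg1. Qed.

Lemma sgn_gen b i : sgn_pow b (gen i) = word [:: (i, b)].
Proof. by case: b => //=; rewrite -word_winv. Qed.

(** The part t2 of the conjugator commutes with x_j. If r were not empty, the image of x_i x_j would
    be conjugate to a cyclically reduced word of length 2 + 2|r|, while it is conjugate to x_i x_j
    or its inverse, of length 2. *)
Lemma primitive_conj_pair phi i j e : is_aut phi -> primitive_conj phi -> i != j ->
  phi (gen i) = sgn_pow e (gen i) ->
  exists t d, only i t /\ phi (gen j) = sgn_pow d (gen j) ^ word t.
Proof.
move=> aphi cphi ij phi_i; have [g [d phi_j]] := primitive_conj_gen j cphi.
have [t1 [r [t2 [o1 o2 [rr gE] h1 h2]]]] := strip_word i j (valP g^-1).
rewrite word_val in gE.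
have {}phi_j : phi (gen j) = word t1 * (word r * sgn_pow d (gen j) * (word r)^-1) * (word t1)^-1.
  rewrite phi_j conjgE gE -[g]invgK gE !invgM !mulgA; congr (_ * _ * _).
  have c : commute (word t2) (sgn_pow d (gen j)).
    by have := only_commute o2; case: d {phi_j} => //= /commuteV.
  by rewrite -!(mulgA _ (word t2)) c !mulgA mulgK.
have [r0|rn0] := eqVneq r [::].
  exists (winv t1), d; split; first by rewrite /only /winv all_rev all_map.
  by rewrite phi_j r0 conjgE word_winv invgK mul1g invg1 mulg1 mulgA.
have ai : avoids i [:: (j, false)] by rewrite /avoids /= eq_sym ij.
have [h [b]] := cphi _ _ ai; rewrite (aut_morph aphi) phi_i -/(gen j) phi_j.
have c : commute (word t1) (sgn_pow e (gen i)).
  by have := only_commute o1; case: (e) => //= /commuteV.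
have {c} -> : sgn_pow e (gen i) * (word t1 * (word r * sgn_pow d (gen j) * (word r)^-1) * (word t1)^-1) =
    word ((i, e) :: r ++ (j, d) :: winv r) ^ (word t1)^-1.
  rewrite conjgE invgK -(cat1s (i, e)) -(cat1s (j, d)) !word_cat -!sgn_gen word_winv !mulgA c.
  by [].
move/(canRL (conjgK _)); rewrite -conjgM invgK => E.
have pE : sgn_pow b (gen i * gen j) = word (if b then winv [:: (i, false); (j, false)] else [:: (i, false); (j, false)]).
  by case: b {E} => /=; rewrite ?word_winv -[_ :: _]cat1s word_cat.
rewrite pE in E.
have nij k1 k2 : nocancel (i, k1) (j, k2) by apply: nocancel_index.
have nji k1 k2 : nocancel (j, k1) (i, k2) by apply: nocancel_index; rewrite eq_sym.
have := conj_cyclic_size (conj_word_cycle e d ij rn0 rr h1 h2) _ _ _ E.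
have -> : size (if b then winv [:: (i, false); (j, false)] else [:: (i, false); (j, false)]) = 2 by case: (b).
rewrite /= size_cat /= => H; have {H} : (size r + (size (winv r)).+1).+1 = 2.
  by apply: H => //; case: (b); rewrite /= ?nij ?nji.
by move=> [] /eqP; rewrite addnS eqSS addn_eq0 size_eq0 (negPf rn0).
Qed.

End Combinatorics.

Lemma elXY_noncomm (F : finFieldType) : (elX (1 : F)%R * elY (1 : F)%R <> elY (1 : F)%R * elX (1 : F)%R).
Proof.
move=> /(congr1 val)/matrixP/(_ 0%R 0%R); rewrite !val_sl2M !val_elX !val_elY !mul_mx2 !mx2E.
by move/eqP; rewrite !GRing.mulr1 GRing.mulr0 -GRing.subr_eq0 GRing.addr0 GRing.addrK GRing.oner_eq0.
Qed.

(** * Recognition of inner automorphisms *)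

Section Inner.
Variable n : nat.
Implicit Types (phi : FG n -> FG n) (i j k : 'I_n).

Lemma conj_aut phi (g : FG n) : is_aut phi -> is_aut (fun u => phi u ^ g).
Proof.
move=> aphi; have [psi apsi [K1 K2]] := inv_aut aphi; split.
  by move=> u v; rewrite (aut_morph aphi) conjMg.
exists (fun u => psi (u ^ g^-1)) => u; first by rewrite conjgK K1.
by rewrite K2 conjgKV.
Qed.

Lemma primitive_conjJ phi (g : FG n) : primitive_conj phi -> primitive_conj (fun u => phi u ^ g).
Proof.
move=> cphi i s /cphi[h [b ->]]; exists (h * g), b; by rewrite conjgM.
Qed.

(** The image of x_k is a conjugate of x_k or its inverse both by a word in x_i and by a word in
    x_j. The endomorphism killing x_j fixes the first expression and removes the conjugator from the
    second. *)
Lemma primitive_conj_third phi i j k e d : is_aut phi -> primitive_conj phi ->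
  i != j -> k != i -> k != j ->
  phi (gen i) = sgn_pow e (gen i) -> phi (gen j) = sgn_pow d (gen j) ->
  exists c, phi (gen k) = sgn_pow c (gen k).
Proof.
move=> aphi cphi ij ki kj phi_i phi_j.
have ik : i != k by rewrite eq_sym.
have jk : j != k by rewrite eq_sym.
have [t [c [ot phi_k]]] := primitive_conj_pair aphi cphi ik phi_i.
have [t' [c' [ot' phi_k']]] := primitive_conj_pair aphi cphi jk phi_j.
pose kappa (l : 'I_n) : FG n := if l == j then 1 else gen l.
have kM := ev_mul kappa.
have kt' : ev kappa t' = 1.
  elim: t' ot' {phi_k'} => [|x t' IH] /=; first by rewrite ev_nil.
  move=> /andP[/eqP xj /IH IHt]; rewrite ev_cons IHt mulg1 /lval xj /kappa eqxx.
  by case: x.2; rewrite ?invg1.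
have kt : ev kappa t = word t.
  rewrite -ev_word; apply: eq_in_ev => x /(allP ot)/eqP ->.
  by rewrite /kappa (negPf ij).
have kk : kappa k = gen k by rewrite /kappa (negPf kj).
have := congr1 (fun u : FG n => ev kappa (val u)) (etrans (esym phi_k) phi_k').
rewrite !(morph_conj _ _ kM) !(morph_sgn _ _ kM) !ev_gen !ev_wordE kt kt' kk conjg1 => E.
by exists c'; rewrite phi_k E.
Qed.

(** Sending x_i to 1 and x_j to -1 in Z/3 kills x_i x_j, hence its image under [phi]; with different
    signs that image would go to 2 or -2. *)
Lemma sign_agree phi i j e d : is_aut phi -> primitive_conj phi -> i != j ->
  phi (gen i) = sgn_pow e (gen i) -> phi (gen j) = sgn_pow d (gen j) -> e = d.
Proof.
move=> aphi cphi ij phi_i phi_j.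
have ai : avoids i [:: (j, false)] by rewrite /avoids /= eq_sym ij.
have [g [b]] := cphi _ _ ai; rewrite (aut_morph aphi) -/(gen j) phi_i phi_j.
pose h (k : 'I_n) : 'I_3 := if k == i then Zp1 else if k == j then Zp1^-1 else 1.
have hM := ev_mul h; move/(congr1 (fun u : FG n => ev h (val u))).
rewrite (morph_conj _ _ hM) (morph_sgn _ _ hM) !hM !(morph_sgn _ _ hM) !ev_gen /h eqxx.
rewrite eq_sym (negPf ij) eqxx mulgV.
have -> : sgn_pow b (1 : 'I_3) = 1 by case: b; rewrite /= ?invg1.
rewrite conj1g; by case: e {phi_i}; case: d {phi_j} => // /(congr1 val).
Qed.

(** Sending x_i, x_j, x_k to A, B, (AB)^-1 kills x_i x_j x_k, hence its image under [phi]. If all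
    signs were negative, this image would go to the commutator of A and B, which is not trivial in
    SL(2,2). *)
Lemma sign_positive phi i j k e : is_aut phi -> primitive_conj phi ->
  i != j -> k != i -> k != j -> phi (gen i) = sgn_pow e (gen i) ->
  phi (gen j) = sgn_pow e (gen j) -> phi (gen k) = sgn_pow e (gen k) -> e = false.
Proof.
move=> aphi cphi ij ki kj phi_i phi_j phi_k; case: e phi_i phi_j phi_k => // phi_i phi_j phi_k.
have ai : avoids i [:: (j, false); (k, false)] by rewrite /avoids /= eq_sym ij ki.
have [g [b]] := cphi _ _ ai; rewrite (word_cat [:: (j, false)]) -/(gen j) -/(gen k).
rewrite !(aut_morph aphi) phi_i phi_j phi_k /=.
pose A : sl2 'F_2 := elX 1; pose B : sl2 'F_2 := elY 1.
pose h (l : 'I_n) := if l == i then A else if l == j then B else if l == k then (A * B)^-1 else 1.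
have hM := ev_mul h; move/(congr1 (fun u : FG n => ev h (val u))).
rewrite (morph_conj _ _ hM) (morph_sgn _ _ hM) !hM !(morph_inv hM) !ev_gen /h eqxx.
rewrite [j == i]eq_sym (negPf ij) (negPf ki) (negPf kj) !eqxx invgK (mulgA A B (A * B)^-1) mulgV.
have -> : sgn_pow b (1 : sl2 'F_2) = 1 by case: b; rewrite /= ?invg1.
rewrite conj1g => E; case: (@elXY_noncomm 'F_2); rewrite -/A -/B.
by apply: (mulgI (B * A)^-1); rewrite mulVg invgM -mulgA -E.
Qed.

Lemma primitive_conj_inner phi : (2 < n)%N -> is_aut phi -> primitive_conj phi ->
  exists g : FG n, forall u, phi u = u ^ g.
Proof.
move=> n3 aphi cphi.
pose i1 : 'I_n := Ordinal (ltnW (ltnW n3)); pose i2 : 'I_n := Ordinal (ltnW n3).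
pose i3 : 'I_n := Ordinal n3.
have [g [e phi1]] := primitive_conj_gen i1 cphi.
pose phi' u := phi u ^ g^-1.
have aphi' : is_aut phi' := conj_aut _ aphi.
have cphi' : primitive_conj phi' := primitive_conjJ _ cphi.
have phi1' : phi' (gen i1) = sgn_pow e (gen i1) by rewrite /phi' phi1 conjgK.
have [t [d [ot phi2']]] := primitive_conj_pair aphi' cphi' (isT : i1 != i2) phi1'.
(* As t involves only x_1, this second conjugation does not disturb the image of x_1. *)
pose psi u := phi' u ^ (word t)^-1.
have apsi : is_aut psi := conj_aut _ aphi'.
have cpsi : primitive_conj psi := primitive_conjJ _ cphi'.
have psi1 : psi (gen i1) = sgn_pow e (gen i1).
  have c : commute (sgn_pow e (gen i1)) (word t).
    by have := commute_sym (only_commute ot); case: (e) => //= c; apply/commute_sym/commuteV/commute_sym.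
  by rewrite /psi phi1' conjgE invgK mulgA -c mulgK.
have psi2 : psi (gen i2) = sgn_pow d (gen i2) by rewrite /psi phi2' conjgK.
have psiE k : exists c, psi (gen k) = sgn_pow c (gen k).
  have [->|k1] := eqVneq k i1; first by exists e.
  have [->|k2] := eqVneq k i2; first by exists d.
  exact: (primitive_conj_third apsi cpsi (isT : i1 != i2) k1 k2 psi1 psi2).
have {}psiE k : psi (gen k) = sgn_pow e (gen k).
  have [->|k1] := eqVneq k i1; first exact: psi1.
  have [c psik] := psiE k; rewrite eq_sym in k1.
  by rewrite (sign_agree apsi cpsi k1 psi1 psik).
have e0 := sign_positive apsi cpsi (isT : i1 != i2) (isT : i3 != i1) (isT : i3 != i2)
  (psiE i1) (psiE i2) (psiE i3).
have psi_id : psi =1 id.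
  by apply: (eq_morph_FG (aut_morph apsi)) => // k; rewrite psiE e0.
exists (word t * g) => u.
by rewrite conjgM -{2}(psi_id u) /psi /phi' !conjgKV.
Qed.

End Inner.

Theorem theorem1p3 (n : nat) (hn : 3 <= n) :
  (forall g : Out n, frattini (@out_mul n) (out_one n) g <-> g = out_one n) /\
  (forall g : Out n, frattini_f (@out_mul n) (out_one n) g <-> g = out_one n).
Proof.
have fone : frattini (@out_mul n) (out_one n) (out_one n) by move=> M [[]].
have ff g : frattini (@out_mul n) (out_one n) g -> frattini_f (@out_mul n) (out_one n) g.
  by move=> fg M maxM _; apply: fg.
suff f1 g : frattini_f (@out_mul n) (out_one n) g -> g = out_one n.
  by split=> g; split=> [|->] //; [move/ff/f1 | apply: f1 | apply: ff].
move=> fg.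
have [h hE] := primitive_conj_inner hn (out_rep_aut g)
  (fun i s avs => frattini_f_primitive_word hn avs fg).
apply: out_inj; rewrite out_repE /=; apply/esym.
apply: (@out_class_eq _ _ _ h) => [||u]; [exact: id_aut | exact: out_rep_aut |].
by rewrite hE conjgE mulKVg.
Qed.
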